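(* Let $N = 2^k$ with $k \geq 5$, and let $n$ be an integer with $9N/32 \leq n \leq 5N/16$. Let $\mathbf{X}_0$ be the regular $16$-run, $5$-factor design ($2^{5-1}$ design) defined by $I = ABCDE$, and let $\mathbf{X}^* = D^{k-4}(\mathbf{X}_0)$ be the $N$-run design with $5N/16$ factors obtained from $\mathbf{X}_0$ by applying the doubling operation $D$ successively $k-4$ times. Then every minimum aberration regular design with $N$ runs and $n$ factors is (up to isomorphism) a projection of $\mathbf{X}^*$ onto $n$ factors.
   Context: All designs have two levels, coded $1$ and $-1$. A design with $N$ runs and $n$ factors is an $N\times n$ matrix with entries $\pm 1$; columns correspond to factors and rows to runs (factor-level combinations). Regular design: a regular $2^{n-p}$ design ($0\le p<n$) is an $N\times n$ matrix with $N = 2^{n-p}$ whose rows are, each once, exactly the vectors $(x_1,\dots,x_n)\in\{1,-1\}^n$ satisfying $p$ equations $\prod_{i\in S_j} x_i = \varepsilon_j$, $j=1,\dots,p$, where $\varepsilon_j\in\{1,-1\}$ and the nonempty subsets $S_j\subseteq\{1,\dots,n\}$ are linearly independent as vectors in $\mathbb{F}_2^n$. A defining word is a nonempty set $S$ of factors such that the componentwise product of the corresponding columns is constant; its length is $|S|$. $B_i$ denotes the number of defining words of length $i$, and $(B_1,\dots,B_n)$ is the wordlength pattern. The design $\mathbf{X}_0$ defined by $I=ABCDE$ is the $16\times 5$ matrix whose rows are all $(x_1,\dots,x_5)\in\{1,-1\}^5$ with $x_1x_2x_3x_4x_5=1$. Minimum aberration: a regular design with $N$ runs and $n$ factors has minimum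 aberration if its wordlength pattern $(B_1,B_2,\dots,B_n)$ is lexicographically smallest among all regular designs with $N$ runs and $n$ factors. Doubling: the double of an $N\times n$ matrix $\mathbf{X}$ is the $2N\times 2n$ matrix $D(\mathbf{X}) = \begin{bmatrix}\mathbf{X}&\mathbf{X}\\ \mathbf{X}&-\mathbf{X}\end{bmatrix}$. Projection: a projection of $\mathbf{X}$ onto $m\le n$ factors is an $N\times m$ matrix formed by $m$ of the columns of $\mathbf{X}$ ($m=n$ is allowed). Designs are identified up to isomorphism: permutation of rows, permutation of columns, and sign changes of columns. *)

(* Defs.v *)
From mathcomp Require Import all_boot all_order all_fingroup all_algebra.

Set Implicit Arguments.
Unset Strict Implicit.
Unset Printing Implicit Defensive.

Import Order.TTheory GRing.Theory Num.Theory.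

Local Open Scope ring_scope.

Definition is_level (x : int) : bool := (x == 1) || (x == -1).

Definition defined_by (N n p : nat) (X : 'M[int]_(N, n))
    (S : 'I_p -> {set 'I_n}) (eps : 'I_p -> int) : Prop :=
  injective (fun r : 'I_N => row r X) /\
  forall x : 'rV[int]_n,
    (exists r : 'I_N, row r X = x) <->
    ((forall i : 'I_n, is_level (x 0 i)) /\
     (forall j : 'I_p, \prod_(i in S j) x 0 i = eps j)).

(* The sets S j are linearly independent over F_2 when this matrix is row_free. *)
Definition indicator_mx (n p : nat) (S : 'I_p -> {set 'I_n}) : 'M['F_2]_(p, n) :=
  \matrix_(j < p, i < n) (i \in S j)%:R.

Definition is_regular (N n : nat) (X : 'M[int]_(N, n)) : Prop :=
  exists (p : nat) (S : 'I_p -> {set 'I_n}) (eps : 'I_p -> int),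
    [/\ (p < n)%N /\ N = (2 ^ (n - p))%N,
        forall j : 'I_p, S j != set0,
        row_free (indicator_mx S),
        forall j : 'I_p, is_level (eps j)
      & defined_by X S eps].

Definition defining_word (N n : nat) (X : 'M[int]_(N, n)) (S : {set 'I_n}) : bool :=
  (S != set0) &&
  [forall r1 : 'I_N, forall r2 : 'I_N,
     \prod_(i in S) X r1 i == \prod_(i in S) X r2 i].

Definition num_words (N n : nat) (X : 'M[int]_(N, n)) (i : nat) : nat :=
  #|[set S : {set 'I_n} | defining_word X S & #|S| == i]|.

(* The entry at (0-based) position i is B_(i+1); [n.-tuplelexi nat] is
   the type of n-tuples ordered lexicographically. *)
Definition wordlength_pattern (N n : nat) (X : 'M[int]_(N, n)) : n.-tuplelexi nat :=
  [tuple num_words X i.+1 | i < n].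

Definition minimum_aberration (N n : nat) (X : 'M[int]_(N, n)) : Prop :=
  is_regular X /\
  forall Y : 'M[int]_(N, n), is_regular Y ->
    (wordlength_pattern X <= wordlength_pattern Y)%O.

Definition double (N n : nat) (X : 'M[int]_(N, n)) : 'M[int]_(N + N, n + n) :=
  block_mx X X X (- X).

Definition twice (d : nat) : nat := (d + d)%N.

Fixpoint iter_double (m N n : nat) (X : 'M[int]_(N, n)) :
    'M[int]_(iter m twice N, iter m twice n) :=
  match m with
  | 0 => X
  | m'.+1 => double (iter_double m' X)
  end.

Definition is_projection (N n m : nat) (P : 'M[int]_(N, m)) (X : 'M[int]_(N, n)) : Prop :=
  exists c : 'I_m -> 'I_n, injective c /\ P = colsub c X.

(* The numbers of rows N and N' are allowed to be merely provably equal (e.g.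
   2 ^ k and [iter (k - 4) twice 16]), so the row permutation is a bijection
   'I_N -> 'I_N', whose existence forces N = N'. *)
Definition isomorphic (N N' n : nat) (X : 'M[int]_(N, n)) (Y : 'M[int]_(N', n)) : Prop :=
  exists (f : 'I_N -> 'I_N') (s : 'S_n) (e : 'I_n -> bool),
    bijective f /\ forall r i, X r i = (-1) ^+ e i * Y (f r) (s i).

(* Main.v *)
(** Up to row permutations and sign changes, a regular design with [N = 2 ^ k]
    runs and no defining word of length at most 3 is a spanning sum-free set [T]
    of [n] points of [F_2^k], and [B_4] counts the 4-subsets of [T] with sum 0,
    equivalently the additive energy of [T].  Averaging over the [n]-subsets of
    the point set [C * F_2^(k-4)] of the doubled design, where [C] is the 5-cap
    [{e1, e2, e3, e4, e1 + e2 + e3 + e4}], gives an upper bound for the least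
    possible [B_4].

    If [T] has no solution of [a + b = c + d + e], then [T + T] and
    [t + T + T] are disjoint, so [T + T] has at most [N / 2] elements and
    Cauchy-Schwarz makes the energy too large.  Otherwise one may assume that [T]
    contains [C * {0}] in [F_2^4 * Q].  Each fibre of [T] over [Q] is then an
    independent set of the Clebsch graph, so it has at most 5 points, with
    equality only for the neighbourhoods [v + C].  As [n >= 9 N / 32], at least
    half of the fibres are such neighbourhoods; sum-freeness forces their centres
    [v] to add up, and to extend to an additive map [Phi] on [Q] with each fibre
    over [x] contained in [Phi x + C], except when [n = 9 N / 32] and [T] is a
    blow-up of a certain 9-cap of [F_2^5], whose energy is again too large.
    The shear [(v, x) |-> (v + Phi x, x)] maps [T] into [C * Q]. *)

Require Import Defs.
From HB Require Import structures.
From Stdlib Require Import ZArith Lia.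
From mathcomp Require Import all_boot all_order all_fingroup all_algebra.
From mathcomp Require Import zify.

Set Implicit Arguments.
Unset Strict Implicit.
Unset Printing Implicit Defensive.

Import Order.TTheory GRing.Theory Num.Theory.

Local Open Scope ring_scope.

(** * Sum-free sets, zero-sum quadruples and energy *)

Definition elementary (G : zmodType) := forall x : G, x + x = 0.

Section Char2.
Variable G : zmodType.
Hypothesis addxx : elementary G.
Implicit Types x y z : G.

Lemma opp2 x : - x = x.
Proof. by apply/eqP; rewrite eq_sym -addr_eq0 addxx. Qed.

Lemma addKK x y : x + (x + y) = y.
Proof. by rewrite addrA addxx add0r. Qed.

Lemma addrKK x y : y + x + x = y.
Proof. by rewrite -addrA addxx addr0. Qed.

Lemma add2_eq0 x y : (x + y == 0) = (x == y).
Proof. by rewrite addr_eq0 opp2. Qed.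

Lemma add_swap x y z t : x + y = z + t -> x + z = y + t.
Proof.
move=> e; have -> : x = z + t + y by rewrite -e addrKK.
by rewrite addrAC (addrAC z t) addxx add0r addrC.
Qed.
End Char2.

Section Counting.
Variable G : finZmodType.
Hypothesis addxx : elementary G.
Implicit Types T A : {set G}.

Definition sum_free T := forall a b, a \in T -> b \in T -> a + b \notin T.

Definition zero_quads T : {set {set G}} :=
  [set A : {set G} | [&& A \subset T, #|A| == 4 & \sum_(x in A) x == 0]].

(** Signs vanish in characteristic 2, so a triple with [a + b + c] in [T] is a solution of a + b = c
    + d in [T]. *)
Definition energy T : nat :=
  (\sum_(a in T) \sum_(b in T) \sum_(c in T) ((a + b + c)%R \in T))%N.

Definition triples T : {set G * G * G} :=
  [set p | [&& p.1.1 \in T, p.1.2 \in T & p.2 \in T]].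

Definition distinct3 (p : G * G * G) :=
  [&& p.1.1 != p.1.2, p.1.1 != p.2 & p.1.2 != p.2].

Definition sum3 (p : G * G * G) := p.1.1 + p.1.2 + p.2.

Lemma energyE T : energy T = #|[set p in triples T | sum3 p \in T]|.
Proof.
rewrite /energy pair_big /= pair_big /= -sum1dep_card.
rewrite [RHS]big_mkcond [LHS]big_mkcond /=; apply: eq_bigr => p _.
rewrite inE -andbA /sum3; do 3!case: (_ \in T) => //=.
Qed.

Lemma card_triples T : #|triples T| = (#|T| ^ 3)%N.
Proof.
have -> : triples T = setX (setX T T) T.
  by apply/setP => -[[a b] c]; rewrite !inE /= andbA.
by rewrite !cardsX; lia.
Qed.

Lemma card_distinct3 T :
  #|[set p in triples T | distinct3 p]| = (#|T| * #|T|.-1 * #|T|.-2)%N.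
Proof.
transitivity (\sum_(a in T) \sum_(b in T :\ a) \sum_(c in T :\ a :\ b) 1)%N.
  rewrite -sum1dep_card (eq_bigr (fun p : G * G * G => (fun q r => 1%N) p.1 p.2)) //.
  under [RHS]eq_bigr do rewrite pair_big_dep /=.
  rewrite pair_big_dep /=.
  rewrite (reindex (fun p : G * (G * G) => (p.1, p.2.1, p.2.2))) /=; last first.
    by exists (fun p => (p.1.1, (p.1.2, p.2))) => [[a [b c]]|[[a b] c]].
  apply: eq_bigl => -[a [b c]] /=; rewrite !inE /distinct3 /=.
  rewrite (eq_sym b a) (eq_sym c a) (eq_sym c b).
  by do 3!case: (_ \in T) => //=; do 3!case: (_ != _).
rewrite (eq_bigr (fun=> #|T|.-1 * #|T|.-2)%N) => [|a aT].
  by rewrite sum_nat_const mulnA.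
have cTa : #|T :\ a| = #|T|.-1 by rewrite [in RHS](cardsD1 a) aT.
rewrite (eq_bigr (fun=> #|T|.-2)) => [|b bT].
  by rewrite sum_nat_const cTa.
by rewrite sum1_card; have := cardsD1 b (T :\ a); rewrite bT cTa => ->.
Qed.

Lemma zero_quad_last (A : {set G}) (a b c : G) :
    #|A| = 4 -> \sum_(x in A) x = 0 -> a \in A -> b \in A -> c \in A ->
    distinct3 (a, b, c) ->
  (a + b + c \in A) /\ A = [set a; b; c; a + b + c].
Proof.
move=> cA sA aA bA cA' /and3P[/= ab ac bc].
have bA1 : b \in A :\ a by rewrite !inE eq_sym ab.
have cA2 : c \in A :\ a :\ b by rewrite !inE eq_sym bc eq_sym ac.
have : #|A :\ a :\ b :\ c| == 1%N.
  have := cardsD1 a A; have := cardsD1 b (A :\ a).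
  have := cardsD1 c (A :\ a :\ b); rewrite aA bA1 cA2 cA; lia.
case/cards1P => d dE.
have dA : d \in A :\ a :\ b :\ c by rewrite dE inE.
have : \sum_(x in A) x = a + b + c + d.
  rewrite (big_setD1 a) //= (big_setD1 b) //= (big_setD1 c) //= dE big_set1.
  by rewrite !addrA.
rewrite sA => /esym/eqP; rewrite (add2_eq0 addxx) => /eqP ->.
have := dA; rewrite !inE => /and4P[_ _ _ ->]; split=> //.
rewrite -(setD1K aA) -(setD1K bA1) -(setD1K cA2) dE.
by apply/setP => x; rewrite !inE !orbA.
Qed.

(** A triple of distinct elements with sum in [T] spans a zero-sum quadruple, and each quadruple
    arises from 4 * 3 * 2 = 24 triples. A triple with a repetition always has its sum in [T]; with n
    = #|T| there are n^3 - n (n - 1) (n - 2) = 3 n^2 - 2 n of these. *)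
Lemma energy_zero_quads T :
  (energy T + 2 * #|T| = 24 * #|zero_quads T| + 3 * #|T| ^ 2)%N.
Proof.
set P := [set p in triples T | distinct3 p & sum3 p \in T].
have cP : #|P| = (24 * #|zero_quads T|)%N.
  pose f (p : G * G * G) := [set p.1.1; p.1.2; p.2; sum3 p].
  rewrite -sum1_card (partition_big f (mem (zero_quads T))) /=.
    rewrite mulnC -sum_nat_const; apply: eq_bigr => A.
    rewrite inE => /and3P[AT /eqP cA /eqP sA].
    transitivity #|[set p in triples A | distinct3 p]|; last first.
      by rewrite card_distinct3 cA.
    rewrite -sum1_card; apply: eq_bigl => -[[a b] c]; rewrite !inE /=.
    apply/andP/andP => [[/and3P[_ dp _] /eqP <-]|[/and3P[aA bA cA'] dp]].
      by rewrite /f /= !inE !eqxx !orbT.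
    have [sA' AE] := zero_quad_last cA sA aA bA cA' dp.
    rewrite dp /sum3 /= !(subsetP AT) //; split=> //.
    by rewrite /f /= /sum3 /= -AE.
  move=> [[a b] c]; rewrite !inE /= => /and3P[/and3P[aT bT cT] dp sT].
  have /and3P[/= ab ac bc] := dp.
  have abc (x y z : G) : (x != y) -> (x + y + z == z) = false.
    move=> xy; apply/negbTE; apply: contraNneq xy => e.
    by rewrite -(add2_eq0 addxx); apply/eqP/(addIr z); rewrite add0r.
  have sc : c != a + b + c by rewrite eq_sym abc.
  have sb : b != a + b + c by rewrite eq_sym addrAC abc.
  have sa : a != a + b + c by rewrite eq_sym -addrA addrC abc.
  apply/and3P; split.
  - by apply/subsetP => x; rewrite !inE -!orbA => /or4P[] /eqP->.
  - rewrite /f /sum3 /= -setUA -setUA !cardsU1 !inE cards1 !negb_or.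
    by rewrite ab ac bc sa sb sc.
  rewrite /f /sum3 /= -setUA -setUA !big_setU1 ?inE ?negb_or ?ab ?ac ?bc ?sa ?sb ?sc //=.
  by rewrite big_set1 addrA addrA (addxx (a + b + c)).
have cQ : #|[set p in triples T | sum3 p \in T]| =
  (#|P| + #|[set p in triples T | ~~ distinct3 p]|)%N.
  rewrite -cardsUI [X in (_ + X)%N](_ : _ = 0)%N; last first.
    apply/eqP; rewrite cards_eq0; apply/eqP/setP => p; rewrite !inE.
    by case: (distinct3 p); rewrite !(andbF, andFb).
  rewrite addn0; apply: eq_card => -[[a b] c]; rewrite !inE /= /sum3 /=.
  case aT: (a \in T); case bT: (b \in T); case cT: (c \in T) => //=.
  case dp : (distinct3 _); rewrite ?orbF ?andbT //=.
  have /negbT := dp; rewrite /distinct3 /= !negb_and !negbK.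
  case/or3P => /eqP->; rewrite ?(addxx) ?add0r ?addrKK //.
  by rewrite addrAC addxx add0r.
have cN : (#|[set p in triples T | distinct3 p]| +
  #|[set p in triples T | ~~ distinct3 p]| = #|T| ^ 3)%N.
  rewrite -card_triples -cardsUI [X in (_ + X)%N](_ : _ = 0)%N; last first.
    apply/eqP; rewrite cards_eq0; apply/eqP/setP => p; rewrite !inE.
    by case: (distinct3 p); rewrite !(andbF, andFb).
  rewrite addn0; apply: eq_card => p; rewrite !inE.
  by case: (distinct3 p); rewrite ?andbT ?andbF ?orbF.
rewrite energyE cQ cP; move: cN; rewrite card_distinct3.
case: #|T| => [|[|n]] /=; [lia|lia|].
rewrite !expnS !expn0; nia.
Qed.

(* On average, an element of [T] lies in [4 * #|zero_quads T| / #|T|] of them. *)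
Lemma zero_quads_del T : T != set0 ->
  exists2 x, x \in T &
    (#|T| * #|zero_quads (T :\ x)| <= (#|T| - 4) * #|zero_quads T|)%N.
Proof.
move=> T0; pose deg x := #|[set A in zero_quads T | x \in A]|.
have dbl : (\sum_(x in T) deg x = 4 * #|zero_quads T|)%N.
  transitivity (\sum_(x in T) \sum_(A in zero_quads T) (x \in A))%N.
    apply: eq_bigr => x _; rewrite /deg -sum1dep_card big_mkcondr /=.
    by apply: eq_bigr => A _; case: (x \in A).
  rewrite exchange_big /= mulnC -sum_nat_const; apply: eq_bigr => A.
  rewrite inE => /and3P[AT /eqP cA _]; transitivity #|A|; last by rewrite cA.
  rewrite -sum1_card [RHS]big_mkcond [LHS]big_mkcond /=; apply: eq_bigr => x _.
  have := subsetP AT x; case: (x \in A) => [-> //|_]; by case: (x \in T).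
have [x xT xE] : exists2 x, x \in T & (4 * #|zero_quads T| <= #|T| * deg x)%N.
  case/set0Pn: T0 => x0 x0T.
  case: (arg_maxnP deg x0T) => x xT xM; exists x => //.
  rewrite -dbl -sum_nat_const; apply: leq_sum => y yT; exact: xM.
exists x => //.
have : (#|zero_quads T| = deg x + #|zero_quads (T :\ x)|)%N.
  rewrite /deg -cardsUI [X in (_ + X)%N](_ : _ = 0)%N ?addn0.
    apply: eq_card => A; rewrite !inE subsetD1.
    by case: (x \in A); rewrite ?andbF ?andbT ?orbF ?orbT //=.
  apply/eqP; rewrite cards_eq0; apply/eqP/setP => A; rewrite !inE subsetD1.
  by case: (x \in A); rewrite !(andbF, andFb).
rewrite mulnBl; nia.
Qed.

(** Elements are deleted one at a time by [zero_quads_del]. Going from size s to s - 1, the factor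
    (s - 4) / s equals C(s - 1, 4) / C(s, 4), so the density of zero quads never increases. *)
Lemma zero_quads_sub T j : (j <= #|T|)%N ->
  exists2 S : {set G}, S \subset T & #|S| = j /\
    (#|zero_quads S| * 'C(#|T|, 4) <= #|zero_quads T| * 'C(j, 4))%N.
Proof.
move=> jT; have [i iE] : exists i, (i + j = #|T|)%N.
  by exists (#|T| - j)%N; rewrite subnK.
elim: i j iE jT => [|i IH] j iE jT; first by exists T => //; rewrite -iE.
have [||S ST [cS wS]] := IH j.+1; [by lia|by lia|].
have [|x xS xE] := @zero_quads_del S; first by rewrite -card_gt0 cS.
have cD : #|S :\ x| = j by have := cardsD1 x S; rewrite xS cS => -[].
exists (S :\ x); first by rewrite (subset_trans _ ST) // subsetDl.
split=> //; move: xE wS; rewrite cS => xE wS.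
have bE : (j.+1 * 'C(j, 4) = (j.+1 - 4) * 'C(j.+1, 4))%N.
  by have := mul_bin_down j.+1 4; rewrite /= => ->.
rewrite -(leq_pmul2l (ltn0Sn j)) (mulnCA _ #|zero_quads T|) bE.
nia.
Qed.

(** In characteristic 2 this counts the ordered pairs of elements of [T] with sum [x]; the energy is
    its second moment. *)
Definition reps T (x : G) : nat := #|[set c in T | x + c \in T]|.

Lemma reps_sum T (F : G -> nat) :
  (\sum_(a in T) \sum_(b in T) F (a + b)%R = \sum_x reps T x * F x)%N.
Proof.
transitivity (\sum_(a in T) \sum_x ((x + a)%R \in T) * F x)%N.
  apply: eq_bigr => a _; rewrite (reindex (fun x => x + a)) /=; last first.
    by exists (fun x => x + a) => x _; rewrite addrKK.
  rewrite big_mkcond /=; apply: eq_bigr => x _.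
  rewrite (addrC a) addrKK //; by case: ifP; rewrite ?mul1n.
rewrite exchange_big /=; apply: eq_bigr => x _.
rewrite -big_distrl /=; congr (_ * _)%N.
rewrite /reps -sum1dep_card big_mkcondr /=; apply: eq_bigr => c _.
by case: (_ \in T).
Qed.

Lemma energy_reps T : energy T = (\sum_x reps T x ^ 2)%N.
Proof.
rewrite /energy (reps_sum T (fun x => \sum_(c in T) ((x + c)%R \in T))%N).
apply: eq_bigr => x _; rewrite expnS expn1; congr (_ * _)%N.
rewrite /reps -sum1dep_card big_mkcondr /=; apply: eq_bigr => c _.
by case: (_ \in T).
Qed.

(** With s = #|A| and R the sum of [f], one adds up 2 (s f_i) R <= (s f_i)^2 + R^2 over [A] and
    cancels s. *)
Lemma cauchy_schwarz_nat (I : finType) (A : {set I}) (f : I -> nat) :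
  ((\sum_(i in A) f i) ^ 2 <= #|A| * \sum_(i in A) f i ^ 2)%N.
Proof.
have [/eqP|sA] := posnP #|A|; first by rewrite cards_eq0 => /eqP ->; rewrite !big_set0.
set s := #|A|; set R := (\sum_(i in A) f i)%N.
have : (\sum_(i in A) (2 * s * R * f i) <= \sum_(i in A) (s ^ 2 * f i ^ 2 + R ^ 2))%N.
  apply: leq_sum => i _; rewrite -expnMn -!mulnA (mulnC R) (mulnA s).
  exact: nat_Cauchy.
rewrite big_split /= sum_nat_const -!big_distrr /= -/s -/R.
move: sA; rewrite -/s; move: (\sum_(i in A) f i ^ 2)%N => S; nia.
Qed.

Definition sumset T : {set G} := [set x | [exists a in T, x + a \in T]].

Lemma sumsetP T x :
  reflect (exists a b, [/\ a \in T, b \in T & x = a + b]) (x \in sumset T).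
Proof.
rewrite inE; apply: (iffP exists_inP) => [[a aT xa]|[a [b [aT bT ->]]]].
  by exists (x + a), a; rewrite addrKK.
by exists b; rewrite ?addrKK.
Qed.

(** The value 0 has #|T| representations and is set apart; Cauchy-Schwarz is applied to the nonzero
    elements of [sumset T], over which the remaining #|T|^2 - #|T| pairs are spread. *)
Lemma energy_sumset T : T != set0 ->
  ((#|T| ^ 2 - #|T|) ^ 2 <= #|sumset T|.-1 * (energy T - #|T| ^ 2))%N.
Proof.
case/set0Pn => t tT; set A := sumset T :\ 0.
have z2 : 0 \in sumset T by apply/sumsetP; exists t, t; rewrite addxx.
have r0 : reps T 0 = #|T|.
  by apply: eq_card => x; rewrite inE add0r andbb.
have rS x : x \notin A -> x != 0 -> reps T x = 0%N.
  rewrite !inE negb_and negbK => + x0; rewrite (negPf x0) /= => nx.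
  apply/eqP; rewrite cards_eq0; apply/eqP/setP => c; rewrite !inE.
  apply/negbTE; apply: contra nx => /andP[cT xc].
  by apply/existsP; exists c; rewrite cT.
have E (F : nat -> nat) : F 0%N = 0%N ->
    (\sum_x F (reps T x) = F #|T| + \sum_(x in A) F (reps T x))%N.
  move=> F0; rewrite (bigD1 0) //= r0; congr (_ + _)%N.
  rewrite big_mkcond [RHS]big_mkcond /=; apply: eq_bigr => x _.
  case: eqP => [->|/eqP x0]; first by rewrite !inE eqxx.
  by case: ifPn => // xA; rewrite rS.
have R1 : (\sum_(x in A) reps T x = #|T| ^ 2 - #|T|)%N.
  have := E id erefl; have := reps_sum T (fun=> 1%N).
  under eq_bigr do rewrite sum1_card.
  under [in RHS]eq_bigr do rewrite muln1.
  rewrite sum_nat_const => <-; rewrite /=; nia.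
have R2 : (\sum_(x in A) reps T x ^ 2 = energy T - #|T| ^ 2)%N.
  by rewrite energy_reps (E (fun n => n ^ 2)%N) // addKn.
have -> : #|sumset T|.-1 = #|A| by rewrite /A (cardsD1 0 (sumset T)) z2.
by rewrite -R1 -R2 cauchy_schwarz_nat.
Qed.

(** The hypothesis makes the translates [w + A] pairwise disjoint. *)
Lemma card_packing (A W : {set G}) :
    (forall w w', w \in W -> w' \in W -> w != w' -> w + w' \notin sumset A) ->
  (#|W| * #|A| <= #|G|)%N.
Proof.
move=> H; rewrite -cardsX.
rewrite -(card_in_imset (f := fun p : G * G => p.1 + p.2)) ?max_card //.
move=> [w a] [w' a']; rewrite !inE /= => /andP[wW aA] /andP[wW' aA'] e.
have [ww|nw] := eqVneq w w'; first by move: e; rewrite ww => /addrI ->.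
case/negP: (H _ _ wW wW' nw); apply/sumsetP; exists a, a'; split=> //.
have -> : w = w' + a' + a by rewrite -e addrKK.
by rewrite -!addrA addrC -!addrA addxx addr0 addrC.
Qed.

Lemma sumset_small T : T != set0 ->
    (forall x, x \in sumset T -> forall t, t \in T -> x + t \notin sumset T) ->
  (2 * #|sumset T| <= #|G|)%N.
Proof.
case/set0Pn => t tT H; set S := sumset T.
have cS : #|[set x + t | x in S]| = #|S| by rewrite card_imset //; exact: addIr.
have : #|S :&: [set x + t | x in S]| = 0%N.
  apply/eqP; rewrite cards_eq0; apply/eqP/setP => y; rewrite !inE -/S.
  apply/negbTE/negP => /andP[yS /imsetP[x xS yE]].
  by have := H x xS t tT; rewrite -yE inE yS.
have := cardsUI S [set x + t | x in S]; rewrite cS => + e; rewrite e => e2.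
by rewrite mul2n -addnn -e2 addn0 max_card.
Qed.

End Counting.

(** * Independent sets of the Clebsch graph *)

(** Lets the results on energy apply to subsets of products such as [V4 * Q]. *)
HB.instance Definition _ (A B : finZmodType) := GRing.Zmodule.on (A * B)%type.

(** F_2^4 with boolean coordinates, a form in which exhaustive searches evaluate by [vm_compute]. *)
Definition V4 := (bool * bool * bool * bool)%type.

Definition V4_list : seq V4 :=
  let b2 := [:: false; true] in
  [seq (p, d) | p <- [seq (q, c) | q <- [seq (a, b) | a <- b2, b <- b2], c <- b2], d <- b2].

Arguments V4_list : simpl never.

Lemma mem_V4 v : v \in V4_list.
Proof. by move: v => [[[[] []] []] []]. Qed.

Lemma V4_elementary : elementary V4.
Proof. by move=> [[[[] []] []] []]. Qed.

Definition cap5 : seq V4 :=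
  [:: (true, false, false, false); (false, true, false, false);
      (false, false, true, false); (false, false, false, true);
      (true, true, true, true)].

(* The Cayley graph of [V4] with connection set [cap5] is the Clebsch graph. *)
Definition indep (A : {set V4}) :=
  forall a b, a \in A -> b \in A -> a + b \notin cap5.

(* Transparent copies of [a + b], [a == b] and [a + b \in cap5] that evaluate
   quickly; the generic operations are slow under [vm_compute]. *)
Definition add4 (x y : V4) : V4 :=
  let: (a, b, c, d) := x in let: (a', b', c', d') := y in
  (xorb a a', xorb b b', xorb c c', xorb d d').

Definition zero4 (x : V4) : bool :=
  match x with (false, false, false, false) => true | _ => false end.

Definition in_cap5 (x : V4) : bool :=
  match x with
  | (true, false, false, false) | (false, true, false, false)
  | (false, false, true, false) | (false, false, false, true)
  | (true, true, true, true) => true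
  | _ => false
  end.

Definition mem4 (x : V4) (s : seq V4) := has (fun y => zero4 (add4 x y)) s.

Lemma add4E x y : add4 x y = x + y.
Proof. by move: x y => [[[[] []] []] []] [[[[] []] []] []]. Qed.

Lemma zero4E x y : zero4 (add4 x y) = (x == y).
Proof. by move: x y => [[[[] []] []] []] [[[[] []] []] []]. Qed.

Lemma in_cap5E x : in_cap5 x = (x \in cap5).
Proof. by move: x => [[[[] []] []] []]. Qed.

Lemma mem4E x s : mem4 x s = (x \in s).
Proof.
by rewrite -has_pred1; apply: eq_has => y; rewrite zero4E eq_sym.
Qed.

(* [P] holds for every extension of [s] by [n] elements to an independent list.
   Conditionals replace [||], both sides of which [vm_compute] evaluates. *)
Fixpoint all_indep n (s : seq V4) (P : pred (seq V4)) : bool :=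
  if n is n'.+1 then
    all (fun v => if mem4 v s then true else
                  if has (fun w => in_cap5 (add4 v w)) s then true else
                  all_indep n' (v :: s) P) V4_list
  else P s.

(** The search conses each new element onto [s], so adding the elements of [t] in turn reaches
    [catrev t s]. *)
Lemma all_indepP n s P : all_indep n s P ->
  forall t, size t = n -> uniq (catrev t s) ->
    (forall a b, a \in catrev t s -> b \in catrev t s -> a + b \notin cap5) ->
  P (catrev t s).
Proof.
elim: n s => [|n IH] s; first by move=> Ps [].
move=> /allP H [//|v t] [st] u ind.
have catE x : (x \in catrev t (v :: s)) = [|| x \in t, x == v | x \in s].
  by rewrite catrevE mem_cat mem_rev inE.
have := H v (mem_V4 v); rewrite mem4E; case: ifP => [+ _|_]; last case: ifP => [+ _|_].
- by move: u; rewrite [catrev _ _]/= catrevE cat_uniq /= => /and3P[_ _ /andP[/negPf ->]].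
- case/hasP => w ws; rewrite in_cap5E add4E => vw; suff: v + w \notin cap5 by rewrite vw.
  by apply: ind; rewrite [catrev _ _]/= catE ?eqxx ?ws !orbT.
move=> Pn; exact: (IH (v :: s) Pn t st u ind).
Qed.

Lemma all_indep_set n P (A : {set V4}) : all_indep n [::] P ->
  indep A -> #|A| = n -> P (enum A).
Proof.
move=> H iA cA; have := all_indepP H (t := rev (enum A)).
rewrite catrevE revK cats0 size_rev -cardE enum_uniq; apply=> //.
by move=> a b; rewrite !mem_enum; apply: iA.
Qed.

(** Containment in [v + cap5], the neighbourhood of [v] in the Clebsch graph. *)
Definition star (v : V4) (s : seq V4) := all (fun a => in_cap5 (add4 a v)) s.

Lemma indep_card A : indep A -> (#|A| <= 5)%N.
Proof.
move=> iA; rewrite leqNgt; apply/negP => c6.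
have [B BA cB] : exists2 B : {set V4}, B \subset A & #|B| = 6.
  exists [set x in take 6 (enum A)].
    by apply/subsetP => x; rewrite inE => /mem_take; rewrite mem_enum.
  rewrite cardsE (card_uniqP _) ?take_uniq ?enum_uniq // size_takel // -cardE //.
(* With the predicate [pred0], success of the search means that no independent 6-set exists. *)
have H : all_indep 6 [::] pred0 by vm_compute.
suff iB : indep B by have := all_indep_set H iB cB.
by move=> a b aB bB; apply: iA; apply: (subsetP BA).
Qed.

Lemma indep5 A : indep A -> #|A| = 5 -> exists v, star v (enum A).
Proof.
have H : all_indep 5 [::] (fun s => has (star^~ s) V4_list) by vm_compute.
by move=> iA cA; have /hasP[v _] := all_indep_set H iA cA; exists v.
Qed.

Definition sumn3 (s1 s2 s3 : seq V4) (f : V4 -> V4 -> V4 -> bool) : nat :=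
  sumn [seq sumn [seq sumn [seq (f a b c : nat) | c <- s3] | b <- s2] | a <- s1].

(** Both sums count the solutions of c + c' = m + m' with c, c' in [cap5] and m, m' in [s]. For the
    sets of [nonstar_spec] there are 5 * 4 with c = c', and 24 others. *)
Definition cross_count (s : seq V4) : bool :=
  (sumn3 cap5 cap5 s (fun c c' m => mem4 (add4 (add4 c c') m) s) == 44) &&
  (sumn3 cap5 s s (fun c m m' => in_cap5 (add4 (add4 c m) m')) == 44).
(* Up to translation, the independent 4-sets outside all the sets [v + cap5] are
   [{0, c_i + c_j, c_i + c_k, c_j + c_k}] with [c_i], [c_j], [c_k] in [cap5]. *)
Definition nonstar_spec (s : seq V4) : bool :=
  [&& all (fun z => all (fun m => ~~ in_cap5 (add4 z m)) s ==> mem4 z s) V4_list,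
   sumn3 s s s (fun m m' m'' => mem4 (add4 (add4 m m') m'') s) == 64
   & cross_count s].

Lemma indep4 A : indep A -> #|A| = 4 ->
  (exists v, star v (enum A)) \/ nonstar_spec (enum A).
Proof.
have H : all_indep 4 [::] (fun s => has (star^~ s) V4_list || nonstar_spec s).
  by vm_compute.
move=> iA cA; have /orP[/hasP[v _ sv]|nA] := all_indep_set H iA cA; last by right.
by left; exists v.
Qed.

(** 65 = 3 * 5^2 - 2 * 5 is the energy of a 5-set without zero quads. *)
Lemma cap5_sum : sumn3 cap5 cap5 cap5 (fun c c' c'' => in_cap5 (add4 (add4 c c') c'')) = 65.
Proof. by vm_compute. Qed.

(** Two distinct vertices of the Clebsch graph have at most two common neighbours. *)
Lemma star_unique (A : {set V4}) (v w : V4) : (2 < #|A|)%N ->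
  (forall a, a \in A -> a + v \in cap5) -> (forall a, a \in A -> a + w \in cap5) -> v = w.
Proof.
move=> cA Av Aw; apply/eqP; apply: contraLR cA => vw; rewrite -leqNgt.
have H : all (fun v => all (fun w => zero4 (add4 v w) ||
    (count (fun a => in_cap5 (add4 a v) && in_cap5 (add4 a w)) V4_list <= 2)%N)
  V4_list) V4_list by vm_compute.
have := allP (allP H v (mem_V4 v)) w (mem_V4 w); rewrite zero4E (negPf vw) orFb.
apply: leq_trans; rewrite -size_filter cardE; apply: uniq_leq_size.
  exact: enum_uniq.
by move=> a; rewrite mem_enum mem_filter mem_V4 andbT !in_cap5E !add4E => aA; rewrite Av ?Aw.
Qed.

(** A vector outside [cap5] is 0 or a sum c_i + c_j of two points of [cap5]. Translation by c_i +
    c_j exchanges c_i and c_j, so at most three points of [cap5] are moved out of it. *)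
Lemma cap5_hit (A : {set V4}) (z : V4) : (3 < #|A|)%N ->
  (forall a, a \in A -> a \in cap5) -> z \notin cap5 ->
  exists2 a, a \in A & a + z \in cap5.
Proof.
move=> cA AC zC; case: (boolP [exists a in A, a + z \in cap5]) => [/exists_inP //|].
rewrite negb_exists_in => /forall_inP Az; move: cA; rewrite ltnNge => /negP[].
have H : all (fun z => in_cap5 z ||
    (count (fun a => ~~ in_cap5 (add4 a z)) cap5 <= 3)%N) V4_list by vm_compute.
have := allP H z (mem_V4 z); rewrite in_cap5E (negPf zC) orFb.
apply: leq_trans; rewrite -size_filter cardE; apply: uniq_leq_size.
  exact: enum_uniq.
by move=> a; rewrite mem_enum mem_filter in_cap5E add4E => aA; rewrite Az ?AC.
Qed.

Lemma pair_elementary (A B : zmodType) :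
  elementary A -> elementary B -> elementary (A * B)%type.
Proof. by move=> eA eB [a b]; congr pair => /=; [apply: eA | apply: eB]. Qed.

Lemma pairD (A B : zmodType) (a a' : A) (b b' : B) :
  (a, b) + (a', b') = (a + a', b + b').
Proof. by []. Qed.

(** * Energy of a set parametrised by a subgroup and a smaller set *)

Section EnergyParam.
Variables (K S0 G : finZmodType) (D : {set K}) (S : {set S0}) (T : {set G}).
Variable g : K -> S0 -> G.
Hypothesis D_add : forall d e, d \in D -> e \in D -> d + e \in D.
Hypothesis g_add : forall d e s t, d \in D -> e \in D ->
  g d s + g e t = g (d + e) (s + t).
Hypothesis g_inj : forall d e s t, d \in D -> e \in D ->
  g d s = g e t -> d = e /\ s = t.
Hypothesis g_mem : forall d s, d \in D -> (g d s \in T) = (s \in S).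
Hypothesis g_surj : forall p, p \in T -> exists2 d, d \in D & exists s, p = g d s.

Lemma sum_param (F : G -> nat) :
  (\sum_(p in T) F p = \sum_(d in D) \sum_(s in S) F (g d s))%N.
Proof.
have -> : T = [set g q.1 q.2 | q in setX D S].
  apply/setP => p; apply/idP/imsetP => [pT|[[d s]]].
    have [d dD [s e]] := g_surj pT; exists (d, s) => //.
    by rewrite in_setX dD -(g_mem s dD) -e.
  by rewrite in_setX => /andP[/= dD sS] ->; rewrite g_mem.
rewrite big_imset /=; last first.
  move=> [d s] [e t]; rewrite !in_setX /= => /andP[dD _] /andP[eD _].
  by case/g_inj => // -> ->.
by rewrite pair_big /=; apply: eq_bigl => -[d s]; rewrite in_setX.
Qed.

Lemma card_param : #|T| = (#|D| * #|S|)%N.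
Proof.
by rewrite -sum1_card sum_param -sum_nat_const; apply: eq_bigr => d _; rewrite sum1_card.
Qed.

(** Whether a sum of three points lies in [T] depends only on their coordinates in [S], so the three
    coordinates in [D] are free. *)
Lemma energy_param : energy T = (#|D| ^ 3 * energy S)%N.
Proof.
rewrite /energy sum_param.
under eq_bigr => d dD. under eq_bigr => s sS. rewrite sum_param.
under eq_bigr => e eD. under eq_bigr => t tS. rewrite sum_param.
under eq_bigr => f fD. under eq_bigr => u uS.
rewrite !g_add ?D_add // g_mem ?D_add //. over. over.
rewrite sum_nat_const. over. rewrite -big_distrr /=. over.
rewrite sum_nat_const. over. rewrite -!big_distrr /=. over.
by rewrite sum_nat_const !expnS expn0 muln1 -!mulnA.
Qed.
End EnergyParam.

Lemma sumn3E s1 s2 s3 (f : V4 -> V4 -> V4 -> bool) :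
  sumn3 s1 s2 s3 f = (\sum_(a <- s1) \sum_(b <- s2) \sum_(c <- s3) f a b c)%N.
Proof.
rewrite /sumn3 sumnE big_map; apply: eq_bigr => a _.
rewrite sumnE big_map; apply: eq_bigr => b _.
by rewrite sumnE big_map.
Qed.

Lemma energy_cap5 : energy [set c : V4 in cap5] = 65.
Proof.
have big_cap (F : V4 -> nat) : (\sum_(c in [set c : V4 in cap5]) F c = \sum_(c <- cap5) F c)%N.
  rewrite big_uniq //; apply: eq_bigl => c; exact: in_set.
rewrite /energy big_cap -cap5_sum sumn3E; apply: eq_bigr => a _.
rewrite big_cap; apply: eq_bigr => b _; rewrite big_cap; apply: eq_bigr => c _.
by rewrite in_set in_cap5E !add4E.
Qed.

(* [M] sits in the coset of [V4] indexed by [true]. *)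
Definition cap_over (M : {set V4}) : {set V4 * bool} :=
  [set s | if s.2 then s.1 \in M else s.1 \in cap5].

Lemma sum_cap_over (M : {set V4}) (F : V4 * bool -> nat) :
  (\sum_(s in cap_over M) F s =
    \sum_(c <- cap5) F (c, false) + \sum_(m <- enum M) F (m, true))%N.
Proof.
rewrite (big_uniq _ (enum_uniq M)) (@big_uniq _ _ _ _ cap5) //.
rewrite big_mkcond (eq_bigr (fun s => (fun v b =>
  if (v, b) \in cap_over M then F (v, b) else 0%N) s.1 s.2)); last by case.
rewrite -(pair_big xpredT xpredT (fun v b => if (v, b) \in cap_over M then F (v, b) else 0%N)) /=.
rewrite [in RHS]big_mkcond [X in (_ + X)%N]big_mkcond -big_split /=.
apply: eq_bigr => v _; rewrite big_bool !in_set mem_enum /= addnC.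
by [].
Qed.

(* [393 = 65 + 6 * 44 + 64]: the four elements of a quadruple lie in [cap5], two
   and two in [cap5] and [M], or in [M]. *)
Lemma energy_cap_over (M : {set V4}) : nonstar_spec (enum M) -> energy (cap_over M) = 393.
Proof.
case/and3P => _ /eqP mmm /andP[/eqP ccm /eqP cmm].
have M1 s : ((s, true) \in cap_over M) = mem4 s (enum M).
  by rewrite in_set mem4E mem_enum.
have M0 s : ((s, false) \in cap_over M) = in_cap5 s by rewrite in_set in_cap5E.
(* [tri b1 b2 b3] is the share of the energy from triples lying over b1, b2, b3. It is symmetric, so
   only the number of [true] arguments matters. *)
pose tri (b1 b2 b3 : bool) := let l b := if b then enum M else cap5 in
  (\sum_(x <- l b1) \sum_(y <- l b2) \sum_(z <- l b3)
     (((x, b1) + (y, b2) + (z, b3))%R \in cap_over M))%N.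
have split2 b1 b2 : (\sum_(x <- if b1 then enum M else cap5)
    \sum_(y <- if b2 then enum M else cap5) \sum_(s in cap_over M)
      (((x, b1) + (y, b2) + s)%R \in cap_over M) = tri b1 b2 false + tri b1 b2 true)%N.
  rewrite /tri -big_split; apply: eq_bigr => x _; rewrite -big_split.
  by apply: eq_bigr => y _; rewrite sum_cap_over.
have split1 b1 : (\sum_(x <- if b1 then enum M else cap5)
    \sum_(s in cap_over M) \sum_(t in cap_over M)
      (((x, b1) + s + t)%R \in cap_over M) =
    tri b1 false false + tri b1 false true + (tri b1 true false + tri b1 true true))%N.
  by rewrite -!split2 -big_split; apply: eq_bigr => x _; rewrite sum_cap_over.
have triC12 b1 b2 b3 : tri b1 b2 b3 = tri b2 b1 b3.
  rewrite /tri exchange_big; apply: eq_bigr => x _; apply: eq_bigr => y _.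
  by apply: eq_bigr => z _; rewrite (addrC (y, b1)).
have triC23 b1 b2 b3 : tri b1 b2 b3 = tri b1 b3 b2.
  rewrite /tri; apply: eq_bigr => x _; rewrite exchange_big.
  by apply: eq_bigr => y _; apply: eq_bigr => z _; rewrite addrAC.
have t0 : tri false false false = 65.
  rewrite -cap5_sum sumn3E; do 3![apply: eq_bigr => ? _].
  by rewrite !pairD M0 !add4E.
have t1 : tri false false true = 44.
  rewrite -ccm sumn3E; do 3![apply: eq_bigr => ? _].
  by rewrite !pairD M1 !add4E.
have t2 : tri false true true = 44.
  rewrite -cmm sumn3E; do 3![apply: eq_bigr => ? _].
  by rewrite !pairD M0 !add4E.
have t3 : tri true true true = 64.
  rewrite -mmm sumn3E; do 3![apply: eq_bigr => ? _].
  by rewrite !pairD M1 !add4E.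
rewrite /energy sum_cap_over (split1 false) (split1 true).
rewrite t0 (triC23 false true false) t1 t2 (triC12 true false false).
by rewrite (triC23 false true false) t1 (triC12 true false true) t2 (triC23 true true false) (triC12 true false true) t2 t3.
Qed.

(** * Sum-free sets containing the 5-cap *)

Section Fibres.
Variables (Q : finZmodType) (T : {set V4 * Q}).
Hypothesis Q2 : elementary Q.
Hypothesis T_sum_free : sum_free T.
Hypothesis T_cap : forall c, c \in cap5 -> (c, 0) \in T.
Hypothesis T_large : (9 * #|Q| <= 2 * #|T|)%N.
Implicit Types (x y z d : Q) (v w a b : V4).

Definition fibre x : {set V4} := [set v | (v, x) \in T].

(** The fibre over [x] is contained in [v + cap5]. A small fibre can have several centres [v]. *)
Definition centred x v := [forall a in fibre x, a + v \in cap5].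

Lemma centredP x v :
  reflect (forall a, (a, x) \in T -> a + v \in cap5) (centred x v).
Proof.
apply: (iffP idP) => [/forall_inP H a aT|H]; first by apply: H; rewrite in_set.
by apply/forall_inP => a; rewrite in_set; apply: H.
Qed.

(** If a + b were in [cap5], then (a, x) + (b, x) = (a + b, 0) would be a point of [T]. *)
Lemma fibre_indep x : indep (fibre x).
Proof.
move=> a b; rewrite !in_set => aT bT; apply/negP => /T_cap cT.
by have := T_sum_free aT bT; rewrite pairD Q2 cT.
Qed.

Lemma fibre_le5 x : (#|fibre x| <= 5)%N.
Proof. exact/indep_card/fibre_indep. Qed.

Lemma star_centred x v : star v (enum (fibre x)) -> centred x v.
Proof.
move=> /allP s; apply/centredP => a aT; rewrite -in_cap5E -add4E.
by apply: s; rewrite mem_enum in_set.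
Qed.

Definition full : {set Q} := [set x | #|fibre x| == 5].
(** Outside [small4] a fibre is large enough for [cap5_hit], and outside [small3] it is large enough
    for [star_unique]. *)
Definition small4 : {set Q} := [set x | #|fibre x| < 4]%N.
Definition small3 : {set Q} := [set x | #|fibre x| < 3]%N.
Definition centre x : V4 := odflt 0 [pick v | centred x v].

Lemma centreP x v : centred x v -> centred x (centre x).
Proof. by rewrite /centre; case: pickP => //= H /negPn; rewrite H. Qed.

Lemma centred_unique x v w : x \notin small3 ->
  centred x v -> centred x w -> v = w.
Proof.
rewrite in_set -leqNgt => c3 /forall_inP xv /forall_inP xw.
exact: star_unique c3 xv xw.
Qed.

Lemma small34 x : x \in small3 -> x \in small4.
Proof. by rewrite !in_set => /ltnW. Qed.

Lemma full_big x : x \in full -> x \notin small4.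
Proof. by rewrite !in_set => /eqP ->. Qed.

Lemma full_centred x : x \in full -> centred x (centre x).
Proof.
rewrite in_set => /eqP /(indep5 (@fibre_indep x)) [v sv].
exact/(@centreP x v)/star_centred.
Qed.

Lemma full_mem x a : x \in full -> ((a, x) \in T) = (a + centre x \in cap5).
Proof.
move=> xF; have xc := full_centred xF.
have fE : fibre x = [set a | a + centre x \in cap5].
  apply/eqP; rewrite eqEcard; apply/andP; split.
    by apply/subsetP => b; rewrite !in_set; apply/centredP.
  have := xF; rewrite in_set => /eqP ->.
  have -> : [set b | b + centre x \in cap5] = [set c + centre x | c in [set c in cap5]].
    apply/setP => b; rewrite in_set; apply/idP/imsetP => [bc|[c + ->]].
      by exists (b + centre x); rewrite ?in_set // addrKK //; exact: V4_elementary.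
    by rewrite in_set addrKK //; exact: V4_elementary.
  by rewrite card_imset ?cardsE ?(leq_trans (card_size _)) //; exact: addIr.
by move/setP/(_ a): fE; rewrite !in_set.
Qed.

(** If (z, x + y) in [T] violated the conclusion, [cap5_hit] applied to the fibre over [y]
    translated by [w] would give b over [y] with (b + z, x) in [T]. Then (z, x + y) = (b + z, x) +
    (b, y) contradicts sum-freeness. *)
Lemma centred_add x y w : x \in full -> y \notin small4 -> centred y w ->
  centred (x + y) (centre x + w).
Proof.
move=> xF; rewrite in_set -leqNgt => cy yw; apply/centredP => z zT.
rewrite addrA; apply/negPn/negP => zC.
have [||//|s] := @cap5_hit [set b + w | b in fibre y] (z + centre x + w).
- by rewrite card_imset //; exact: addIr.
- by move=> s /imsetP[b + ->]; rewrite in_set => bT; exact: (centredP _ _ yw).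
case/imsetP => b; rewrite in_set => bT ->.
rewrite addrACA V4_elementary addr0 addrA -full_mem // => bzT.
have := T_sum_free bzT bT.
by rewrite pairD addrAC V4_elementary add0r zT.
Qed.

Lemma card_cap5 : #|[set c : V4 in cap5]| = 5.
Proof. by rewrite cardsE; apply/card_uniqP. Qed.

Lemma fibre0 : fibre 0 = [set c in cap5].
Proof.
apply/esym/eqP; rewrite eqEcard card_cap5 fibre_le5 andbT.
by apply/subsetP => c; rewrite !in_set => /T_cap.
Qed.

Lemma zero_full : 0 \in full.
Proof. by rewrite in_set fibre0 card_cap5. Qed.

Lemma sum_fibres (F : V4 * Q -> nat) :
  (\sum_(p in T) F p = \sum_x \sum_(v in fibre x) F (v, x))%N.
Proof.
rewrite pair_big_dep /= (reindex (fun p : V4 * Q => (p.2, p.1))) /=; last first.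
  by exists (fun p : Q * V4 => (p.2, p.1)) => -[].
by apply: eq_big => [[v x]|[v x] _] //=; rewrite in_set.
Qed.

(* [5 - #|fibre x|] is at least the number of sets among [~: full], [small4] and
   [small3] to which [x] belongs. *)
Lemma deficit : (2 * (#|~: full| + #|small4| + #|small3|) <= #|Q|)%N.
Proof.
have cards (A : {set Q}) : #|A| = (\sum_x (x \in A))%N.
  by rewrite -sum1_card big_mkcond /=; apply: eq_bigr => x _; case: (_ \in _).
have cT : #|T| = (\sum_x #|fibre x|)%N.
  rewrite -sum1_card (sum_fibres (fun=> 1%N)); apply: eq_bigr => x _.
  by rewrite sum1_card.
have : (#|T| + #|~: full| + #|small4| + #|small3| <= 5 * #|Q|)%N.
  rewrite cT !cards -!big_split /= mulnC -sum_nat_const.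
  apply: leq_sum => x _; rewrite !in_set.
  by have := fibre_le5 x; case: #|_| => [|[|[|[|[|[|?]]]]]].
lia.
Qed.

(** Each such [d] writes [x] as the sum of two full points [d] and [x + d], and so yields a centre
    for the fibre over [x]. *)
Definition overlap x : {set Q} := [set d in full | x + d \in full].

Lemma mem_overlap x d : (d \in overlap x) = (d \in full) && (x + d \in full).
Proof. by rewrite in_set. Qed.

Lemma card_shift x (A : {set Q}) : #|[set d | x + d \in A]| = #|A|.
Proof.
rewrite -[RHS](card_imset _ (addrI x)); apply: eq_card => d.
rewrite in_set; apply/idP/imsetP => [xd|[e eA ->]]; last by rewrite addKK.
by exists (x + d); rewrite // addKK.
Qed.

(** By inclusion-exclusion for [full] and its translate by [x], the overlap has at least |Q| - 2
    #|~: full| elements; [deficit] does the rest. *)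
Lemma card_overlap x : (2 * #|small4| + 2 * #|small3| <= #|overlap x|)%N.
Proof.
have E : overlap x = full :&: [set d | x + d \in full].
  by apply/setP => d; rewrite !in_set.
set B := [set d | x + d \in full].
have cU : (#|full :|: B| + #|overlap x| = #|full| + #|full|)%N.
  by rewrite E cardsUI card_shift.
have mU : (#|full :|: B| <= #|Q|)%N := max_card _.
have cC : (#|full| + #|~: full| = #|Q|)%N := cardsC full.
have := deficit; lia.
Qed.

(** The bad [d] lie in a translate of [small4], while the overlap is nonempty and at least twice as
    large as [small4]. *)
Lemma overlap_avoid x y : overlap x != set0 ->
  exists2 d, d \in overlap x & y + d \notin small4.
Proof.
move=> x0; case: (boolP [exists d in overlap x, y + d \notin small4]) => [/exists_inP //|].
rewrite negb_exists_in => /forall_inP H.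
have s0 : small4 != set0.
  case/set0Pn: x0 => d /H; rewrite negbK => ds; apply/set0Pn; by exists (y + d).
set B := [set d | y + d \in small4].
have : (#|overlap x| <= #|B|)%N.
  by apply: subset_leq_card; apply/subsetP => d /H; rewrite negbK => dB; rewrite in_set.
rewrite card_shift; have := card_overlap x; rewrite -card_gt0 in s0; lia.
Qed.

(** The bad [d] lie in two translates of [small3]. If these covered the overlap, [card_overlap]
    would make [small4], hence [small3] and the overlap, empty. *)
Lemma overlap_avoid2 x y z : overlap x != set0 ->
  exists d, [/\ d \in overlap x, y + d \notin small3 & z + d \notin small3].
Proof.
move=> x0; case: (boolP [exists d in overlap x, (y + d \notin small3) && (z + d \notin small3)]).
  by case/exists_inP => d dx /andP[? ?]; exists d.
rewrite negb_exists_in => /forall_inP H.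
set B1 := [set d | y + d \in small3]; set B2 := [set d | z + d \in small3].
have xB : overlap x \subset B1 :|: B2.
  by apply/subsetP => d /H; rewrite negb_and !negbK => dB; rewrite in_setU;
    apply/orP; case/orP: dB; [left | right]; rewrite in_set.
have : (#|overlap x| <= 2 * #|small3|)%N.
  have := subset_leq_card xB; have := cardsU B1 B2.
  have -> : #|B1| = #|small3| := card_shift _ _.
  have -> : #|B2| = #|small3| := card_shift _ _.
  move: #|B1 :|: B2| #|B1 :&: B2| => ? ?; lia.
have := card_overlap x; have : (#|small3| <= #|small4|)%N.
  by apply: subset_leq_card; apply/subsetP => ? /small34.
move: x0; rewrite -card_gt0; lia.
Qed.

Lemma full2_centred d e : d \in full -> e \in full ->
  centred (d + e) (centre d + centre e).
Proof. by move=> dF eF; apply: centred_add; rewrite ?full_big ?full_centred. Qed.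

Lemma overlap_centred x d : d \in overlap x -> centred x (centre d + centre (x + d)).
Proof.
rewrite in_set => /andP[dF xdF]; have := full2_centred dF xdF.
by rewrite addrCA Q2 addr0.
Qed.

(* The points [d] and [e] are linked through a third one [f], for which
   [d + f] and [e + f] have fibres large enough to determine their centres. *)
Lemma overlap_unique x d e : d \in overlap x -> e \in overlap x ->
  centre d + centre (x + d) = centre e + centre (x + e).
Proof.
move=> dx ex.
have x0 : overlap x != set0 by apply/set0Pn; exists d.
have [f [fx df ef]] := overlap_avoid2 d e x0.
have link g : g \in overlap x -> g + f \notin small3 ->
    centre g + centre (x + g) = centre f + centre (x + f).
  rewrite in_set => /andP[gF xgF] gf.
  move: fx; rewrite in_set => /andP[fF xfF].
  (* The point [g + f] is also the sum of the full points [x + g] and [x + f], so its only centre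
     has two expressions. *)
  have c1 := full2_centred gF fF.
  have c2 := full2_centred xgF xfF.
  rewrite addrACA Q2 add0r in c2.
  exact: (add_swap V4_elementary (centred_unique gf c1 c2)).
by rewrite (link d) // (link e).
Qed.

(** The centre imposed on [x] by two full points, meaningful even if the fibre over [x] does not
    determine one. The default 0 for [d] occurs only for an empty overlap. *)
Definition extend x : V4 :=
  let d := odflt 0 [pick d in overlap x] in centre d + centre (x + d).

Lemma extendE x d : d \in overlap x -> extend x = centre d + centre (x + d).
Proof.
move=> dx; rewrite /extend; case: pickP => [e ex|/(_ d)] /=.
  exact: overlap_unique.
by rewrite dx.
Qed.

Lemma centre0 : centre 0 = 0.
Proof.
apply: (@centred_unique 0) (full_centred zero_full) _.
  by apply/negP => /small34; apply/negP; rewrite full_big ?zero_full.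
by apply/forall_inP => a; rewrite fibre0 in_set addr0.
Qed.

Lemma extend_full z : z \in full -> extend z = centre z.
Proof.
move=> zF; rewrite (@extendE z z) ?Q2 ?centre0 ?addr0 //.
by rewrite in_set zF Q2 zero_full.
Qed.

(** The centre over [z + d] is computed twice: from [z] and [d], and from [x + z + w] and [x + d],
    whose sum is [z + d + w], followed by adding [w]. The choices of [d] and [w] make the fibres
    over [z + d] and [z + d + w] large enough. *)
Lemma extend_add x z : (forall y, overlap y != set0) -> z \in full ->
  extend (x + z) = extend x + centre z.
Proof.
move=> ov zF.
have [d dx dz] := overlap_avoid z (ov x).
have [w wx wz] := overlap_avoid (z + d) (ov (x + z)).
rewrite (extendE dx) (extendE wx).
move: dx wx; rewrite !mem_overlap => /andP[dF xdF] /andP[wF xwF].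
have c1 := full2_centred xwF xdF.
have e1 : x + z + w + (x + d) = z + d + w.
  by rewrite (AC (3*2) ((1*4)*((2*5)*3))) /= Q2 add0r.
rewrite e1 in c1.
have c2 := centred_add wF wz c1.
rewrite addrC addrKK // in c2.
have c3 := full2_centred zF dF.
have dz3 : z + d \notin small3 by apply: contra dz => /small34.
have e := centred_unique dz3 c2 c3.
apply: (@addIr _ (centre (x + d))); rewrite -addrA e.
by rewrite [RHS](AC (3*1) ((3*1)*(2*4))) /= V4_elementary addr0.
Qed.

(** [full] fills at least half of [Q] by [deficit]; being disjoint from its translate by [y], it
    partitions [Q] together with it. *)
Lemma overlap_empty y : overlap y = set0 ->
  small4 = set0 /\ forall x, (x + y \in full) = (x \notin full).
Proof.
move=> y0; have /eqP s0 : small4 == set0.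
  rewrite -cards_eq0; have := card_overlap y; rewrite y0 cards0; lia.
split=> // x; set B := [set d | y + d \in full].
have E : full :&: B = set0 by rewrite -y0; apply/setP => d; rewrite mem_overlap in_setI; congr andb; rewrite in_set.
have cU : (#|full :|: B| + 0 = #|full| + #|full|)%N.
  by rewrite -(cards0 Q) -E cardsUI card_shift.
have cC : (#|full| + #|~: full| = #|Q|)%N := cardsC full.
have le : (#|Q| <= #|full :|: B|)%N by have := deficit; lia.
have UT : full :|: B = setT.
  by apply/eqP; rewrite eqEcard subsetT (leq_trans _ le) // cardsT.
have xB : (x \in B) = (x + y \in full) by rewrite in_set addrC.
rewrite -xB; apply/idP/negP => [xB' xF|nx].
  by have := in_set0 x; rewrite -E in_setI xF xB'.
by have := in_setT x; rewrite -UT in_setU => /orP[].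
Qed.

(** If [overlap y] is nonempty, [y] is a sum of two full points. Otherwise [x] or [x + y] is full,
    and y = x + (x + y). *)
Lemma additive_of_full (Phi : Q -> V4) :
    (forall x z, z \in full -> Phi (x + z) = Phi x + Phi z) ->
  forall x y, Phi (x + y) = Phi x + Phi y.
Proof.
move=> H x y; case: (set_0Vmem (overlap y)) => [y0|[d]].
  have [xF|xF] := boolP (x \in full); first by rewrite addrC H // addrC.
  have [_ /(_ x)] := overlap_empty y0; rewrite xF => xyF.
  have -> : Phi y = Phi x + Phi (x + y) by rewrite -H ?xyF // addKK.
  by rewrite addKK //; exact: V4_elementary.
rewrite in_set => /andP[dF ydF].
have -> : Phi y = Phi d + Phi (y + d) by rewrite -H // addrCA Q2 addr0.
by rewrite addrA -!H // addrACA Q2 addr0.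
Qed.

(* Here [full] is a subgroup of index 2, and [T] is the sum of its lift by
   [centre] and a 9-cap made of [cap5] and [fibre y0]. *)
Section Exceptional.
Variable y0 : Q.
Hypothesis y0_empty : overlap y0 = set0.
Hypothesis y0_nocentre : forall v, ~~ centred y0 v.

Let small40 x : x \notin small4.
Proof. by have [-> _] := overlap_empty y0_empty; rewrite in_set0. Qed.

Let shift_full x : (x + y0 \in full) = (x \notin full).
Proof. by have [_ ->] := overlap_empty y0_empty. Qed.

Let small30 x : x \notin small3.
Proof. by apply: contra (small40 x) => /small34. Qed.

(** Here [x + y0] is full, and adding it would carry a centre from [x] to [y0]. *)
Lemma exc_nocentre x v : x \notin full -> ~~ centred x v.
Proof.
rewrite -shift_full => xF; apply/negP => xv.
have := centred_add xF (small40 x) xv.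
by rewrite (addrC x) addrKK //; apply/negP.
Qed.

Lemma exc_full_add d e : d \in full -> e \in full -> d + e \in full.
Proof.
move=> dF eF; apply/negPn/negP => /exc_nocentre/negP H.
exact: H (full2_centred dF eF).
Qed.

Lemma exc_centre_add d e : d \in full -> e \in full ->
  centre (d + e) = centre d + centre e.
Proof.
move=> dF eF; apply: (centred_unique (small30 (d + e))).
  exact/full_centred/exc_full_add.
exact: full2_centred.
Qed.

Lemma exc_fibre4 x : x \notin full -> #|fibre x| = 4.
Proof.
move=> xF; have := small40 x; rewrite in_set -leqNgt => c4.
by have := fibre_le5 x; move: xF c4; rewrite in_set; lia.
Qed.

Lemma exc_y0 : y0 \notin full.
Proof. by apply/negP => /full_centred; apply/negP. Qed.

Lemma exc_nonstar : nonstar_spec (enum (fibre y0)).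
Proof.
case: (indep4 (@fibre_indep y0) (exc_fibre4 exc_y0)) => // -[v /star_centred].
by move/negP: (y0_nocentre v).
Qed.

Lemma exc_mem d v : d \in full ->
  ((v, y0 + d) \in T) = (v + centre d \in fibre y0).
Proof.
move=> dF; have e4 := V4_elementary.
have sub u : (u, y0 + d) \in T -> u + centre d \in fibre y0.
  (* The first clause of [nonstar_spec] says that [fibre y0] is a maximal independent set, so it is
     enough that [u + centre d] has no neighbour in it; a neighbour m would put (u + m, d) in
     [T]. *)
  move=> uT; have /and3P[/allP/(_ _ (mem_V4 (u + centre d))) + _ _] := exc_nonstar.
  rewrite mem4E mem_enum => /implyP; apply; apply/allP => m.
  rewrite mem_enum in_set => mT; rewrite in_cap5E add4E addrAC -full_mem //.
  by have := T_sum_free uT mT; rewrite pairD (addrC y0) addrKK.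
have E : [set u + centre d | u in fibre (y0 + d)] = fibre y0.
  apply/eqP; rewrite eqEcard; apply/andP; split.
    by apply/subsetP => w /imsetP[u + ->]; rewrite in_set => /sub.
  have nF : y0 + d \notin full by rewrite addrC shift_full negbK.
  by rewrite card_imset ?exc_fibre4 ?exc_y0 //; exact: addIr.
apply/idP/idP => [/sub //|]; rewrite -E => /imsetP[u + /addIr ->].
by rewrite in_set.
Qed.

(** The lift (centre d, d) of [d], plus a point of the 9-cap placed over 0 and [y0]. *)
Let gexc (d : Q) (s : V4 * bool) : V4 * Q :=
  (centre d + s.1, d + (if s.2 then y0 else 0)).

Lemma exceptional_energy : exists h : nat,
  [/\ #|Q| = (2 * h)%N, #|T| = (9 * h)%N & energy T = (393 * h ^ 3)%N].
Proof.
have e4 := V4_elementary; exists #|full|.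
have g_add d e s t : d \in full -> e \in full ->
    gexc d s + gexc e t = gexc (d + e) (s + t).
  move=> dF eF; rewrite /gexc pairD exc_centre_add // addrACA; congr pair.
  rewrite addrACA; congr (_ + _); case: s t => [? []] [? []] //=.
    by rewrite addr0.
  by rewrite add0r.
have g_inj d e s t : d \in full -> e \in full ->
    gexc d s = gexc e t -> d = e /\ s = t.
  move=> dF eF E; have E1 : centre d + s.1 = centre e + t.1 := congr1 fst E.
  have E2 : d + (if s.2 then y0 else 0) = e + (if t.2 then y0 else 0) := congr1 snd E.
  have sb : s.2 = t.2.
    case: (s.2) (t.2) E2 => [] [] //=; rewrite addr0.
      by move=> Ed; have := shift_full d; rewrite Ed eF dF.
    by move=> Ee; have := shift_full e; rewrite -Ee eF dF.
  have de : d = e by move: E2; rewrite sb => /addIr.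
  split=> //; move: E1; rewrite de => /addrI.
  by case: s t sb {E E2} => ? ? [? ?] /= -> ->.
have g_mem d s : d \in full -> (gexc d s \in T) = (s \in cap_over (fibre y0)).
  move=> dF; rewrite in_set /gexc; case: s => v [] /=.
    by rewrite (addrC d) exc_mem // addrAC e4 add0r.
  by rewrite addr0 full_mem // addrAC e4 add0r.
have g_surj p : p \in T -> exists2 d, d \in full & exists s, p = gexc d s.
  case: p => v x xT; have [xF|xF] := boolP (x \in full).
    exists x => //; exists (v + centre x, false).
    by rewrite /gexc /= addr0 (addrC v) addKK.
  exists (x + y0); first by rewrite shift_full.
  by exists (v + centre (x + y0), true); rewrite /gexc /= addrKK // (addrC v) addKK.
have cQ : #|Q| = (2 * #|full|)%N.
  have cC : #|~: full| = #|full|.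
    rewrite -(card_shift y0 full); apply: eq_card => x.
    by rewrite in_setC [RHS]in_set addrC shift_full.
  have := cardsC full; rewrite cC => <-; lia.
have cS : #|cap_over (fibre y0)| = 9.
  have := sum_cap_over (fibre y0) (fun=> 1%N).
  by rewrite sum1_card !sum1_size -cardE exc_fibre4 ?exc_y0.
split=> //.
  by rewrite (card_param g_inj g_mem g_surj) cS mulnC.
rewrite (energy_param exc_full_add g_add g_inj g_mem g_surj).
by rewrite (energy_cap_over exc_nonstar) mulnC.
Qed.
End Exceptional.


(** If no overlap is empty, [extend] is the additive map. Otherwise [small4] is empty: either all
    fibres have centres and [centre] itself is additive, or some fibre has none, its overlap is
    empty by [overlap_centred], and the exceptional case arises. *)
Theorem sum_free_structure : (exists Phi : Q -> V4,
    (forall x y, Phi (x + y) = Phi x + Phi y) /\ (forall x, centred x (Phi x))) \/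
  exists h : nat, [/\ #|Q| = (2 * h)%N, #|T| = (9 * h)%N & energy T = (393 * h ^ 3)%N].
Proof.
have [/forallP ov|] := boolP [forall y, overlap y != set0].
  left; exists extend; split.
    by apply: additive_of_full => x z zF; rewrite (extend_full zF) (extend_add x ov zF).
  move=> x; have /set0Pn[d dx] := ov x.
  by rewrite (extendE dx) overlap_centred.
rewrite negb_forall => /existsP[y]; rewrite negbK => /eqP y0.
have small40 x : x \notin small4.
  by have [-> _] := overlap_empty y0; rewrite in_set0.
have [/forallP cen|] := boolP [forall x, centred x (centre x)].
  left; exists centre; split=> //; apply: additive_of_full => x z zF.
  apply: (@centred_unique (x + z)) => //.
    by apply: contra (small40 (x + z)) => /small34.
  by rewrite (addrC x) (addrC (centre x)); apply: centred_add.
rewrite negb_forall => /existsP[x xc]; right.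
have nx v : ~~ centred x v by apply: contra xc; apply: centreP.
apply: (@exceptional_energy x) => //.
case: (set_0Vmem (overlap x)) => // -[d /overlap_centred].
by move/negP: (nx (centre d + centre (x + d))).
Qed.

End Fibres.

(** * Regular designs as point sets *)

Definition sgn (b : bool) : int := (-1) ^+ b.

Lemma sgnD a b : sgn (a + b) = sgn a * sgn b.
Proof. exact: signr_addb. Qed.

Lemma sgn_inj : injective sgn.
Proof. by move=> [] []. Qed.

Lemma sgn_level b : is_level (sgn b).
Proof. by case: b. Qed.

Lemma level_sgn z : is_level z -> z = sgn (z == -1).
Proof. by case/orP => /eqP ->. Qed.

Lemma prod_sgn (I : finType) (A : {set I}) (f : I -> bool) :
  \prod_(i in A) sgn (f i) = sgn (\sum_(i in A) f i).
Proof. by rewrite (big_morph sgn sgnD (erefl _)). Qed.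

Lemma mx_elementary m n : elementary 'M[bool]_(m, n).
Proof. by move=> A; apply/matrixP => i j; rewrite !mxE; case: (A i j). Qed.

(** The field isomorphism that carries row-freeness from [indicator_mx] to boolean matrices. *)
Definition b2F (b : bool) : 'F_2 := if b then 1 else 0.

Lemma b2F_additive : zmod_morphism b2F.
Proof. by move=> [] []; apply/val_inj. Qed.

Lemma b2F_multiplicative : monoid_morphism b2F.
Proof. by split=> // [] [] []; apply/val_inj. Qed.

HB.instance Definition _ := GRing.isZmodMorphism.Build bool 'F_2 b2F b2F_additive.
HB.instance Definition _ := GRing.isMonoidMorphism.Build bool 'F_2 b2F b2F_multiplicative.

Definition parity_mx n p (S : 'I_p -> {set 'I_n}) : 'M[bool]_(p, n) :=
  \matrix_(j, i) (i \in S j).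

Lemma row_free_parity n p (S : 'I_p -> {set 'I_n}) :
  row_free (indicator_mx S) = row_free (parity_mx S).
Proof.
rewrite -(row_free_map b2F); congr row_free; apply/matrixP => j i.
by rewrite !mxE; case: (i \in S j).
Qed.

Lemma parity_prod n p (S : 'I_p -> {set 'I_n}) (b : 'cV[bool]_n) j :
  \prod_(i in S j) sgn (b i 0) = sgn ((parity_mx S *m b) j 0).
Proof.
rewrite prod_sgn; congr sgn; rewrite mxE [LHS]big_mkcond; apply: eq_bigr => i _.
by rewrite mxE; case: (i \in S j); rewrite ?mul1r ?mul0r.
Qed.

(* Up to the sign changes [e], column [i] of [X] is the character of the row
   space ['rV_k] attached to the point [col i B]. *)
Definition represents (N n k : nat) (X : 'M[int]_(N, n)) (B : 'M[bool]_(k, n))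
    (e : 'I_n -> bool) (u : 'I_N -> 'rV[bool]_k) : Prop :=
  (forall r i, X r i = sgn (e i + (u r *m B) 0 i)) /\ (forall v, exists r, u r = v).

(** Written as bits, the rows of [X] form a coset of the kernel of the parity matrix, which has
    dimension n - p = k. The rows of [B] are a basis of this kernel, [e] is the row [r0], and [u r]
    gives the coordinates of row r minus row [r0]. *)
Lemma regular_represented (N n k : nat) (X : 'M[int]_(N, n)) :
  N = (2 ^ k)%N -> is_regular X ->
  exists (B : 'M[bool]_(k, n)) e u, row_free B /\ represents X B e u.
Proof.
move=> Nk [p [S [eps [[pn NE] _ Sfree epsl [Xinj Xrows]]]]].
rewrite row_free_parity in Sfree; set M := parity_mx S.
have kE : (n - p)%N = k by apply/eqP; rewrite -(eqn_exp2l (m := 2)) // -NE Nk.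
set K := kermx M^T.
have rK : \rank K = k by rewrite mxrank_ker mxrank_tr (eqP Sfree).
have [B [Bfree BK]] : exists B : 'M[bool]_(k, n), row_free B /\ (B :=: K)%MS.
  move: (row_base K) (row_base_free K) (eq_row_base K); rewrite rK => B f e.
  by exists B.
have Xl r i : is_level (X r i).
  have [H _] := Xrows (row r X); have [] := H (ex_intro _ r erefl).
  by move=> /(_ i); rewrite mxE.
pose bits r : 'cV[bool]_n := \col_i (X r i == -1).
have bitsE r i : X r i = sgn (bits r i 0) by rewrite mxE -level_sgn.
have Mbits r : forall j, sgn ((M *m bits r) j 0) = eps j.
  move=> j; have [H _] := Xrows (row r X); have [_] := H (ex_intro _ r erefl).
  move=> /(_ j) <-; rewrite -parity_prod; apply: eq_bigr => i _.
  by rewrite -bitsE mxE.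
have N0 : (0 < N)%N by rewrite Nk expn_gt0.
pose r0 := Ordinal N0.
pose d r := (bits r + bits r0)^T.
have dB r : (d r <= B)%MS.
  rewrite BK; apply/sub_kermxP; rewrite /d -trmx_mul mulmxDr.
  suff -> : M *m bits r = M *m bits r0 by rewrite mx_elementary trmx0.
  by apply/matrixP => j i; rewrite ord1; apply: sgn_inj; rewrite !Mbits.
exists B, (fun i => bits r0 i 0), (fun r => d r *m pinvmx B); split=> //; split.
  move=> r i; rewrite mulmxKpV // bitsE; congr sgn.
  have -> : d r 0 i = bits r i 0 + bits r0 i 0 by rewrite /d mxE mxE.
  by case: (bits r i 0); case: (bits r0 i 0).
move=> v; pose b := bits r0 + (v *m B)^T.
have Mb : M *m b = M *m bits r0.
  rewrite mulmxDr -[X in _ + X]trmxK trmx_mul trmxK.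
  have /sub_kermxP -> : (v *m B <= K)%MS by rewrite -BK submxMl.
  by rewrite trmx0 addr0.
have [_ [|r rE]] := Xrows (\row_i sgn (b i 0)).
  split=> [i|j]; first by rewrite mxE sgn_level.
  rewrite -(Mbits r0) -Mb -parity_prod; apply: eq_bigr => i _; by rewrite mxE.
exists r; apply: (row_free_inj Bfree); rewrite mulmxKpV // /d.
have -> : bits r = b.
  apply/matrixP => i j; rewrite ord1; apply: sgn_inj; rewrite -bitsE.
  by move/matrixP/(_ 0 i): rE; rewrite !mxE.
by rewrite /b addrAC mx_elementary add0r trmxK.
Qed.

(** The defining equations, all with sign 1, come from a basis [M] of the linear relations between
    the columns of [B]; the vectors killed by [M] are exactly the row space of [B]. *)
Lemma regular_of_points (N n k : nat) (X : 'M[int]_(N, n)) (B : 'M[bool]_(k, n)) u :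
    N = (2 ^ k)%N -> (0 < k)%N -> row_free B -> injective u ->
  represents X B (fun=> false) u -> is_regular X.
Proof.
move=> NE k0 Bfree uinj [XE usurj].
have kn : (k <= n)%N by rewrite -(eqP Bfree) rank_leq_col.
set K := kermx B^T; set M := row_base K.
have rK : \rank K = (n - k)%N by rewrite mxrank_ker mxrank_tr (eqP Bfree).
pose S (j : 'I_(\rank K)) := [set i | M j i].
have MS : parity_mx S = M by apply/matrixP => j i; rewrite mxE in_set.
have MB : M *m B^T = 0 by apply/sub_kermxP; rewrite eq_row_base.
exists (\rank K), S, (fun=> 1); split=> //.
- by rewrite rK; split; [lia | rewrite subKn].
- move=> j; apply/negP => /eqP Sj.
  have : row j M = 0.
    apply/rowP => i; rewrite mxE [RHS]mxE; have := in_set0 i.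
    by rewrite -Sj in_set.
  rewrite rowE => /eqP; rewrite mulmx_free_eq0 ?row_base_free // => /eqP/rowP/(_ j).
  by rewrite !mxE !eqxx.
- by rewrite row_free_parity MS row_base_free.
split.
  move=> r s /rowP E; apply: uinj; apply: (row_free_inj Bfree); apply/rowP => i.
  by have := E i; rewrite [row r X _ _]mxE [row s X _ _]mxE !XE !add0r => /sgn_inj.
move=> x; split.
  case=> r <-; split=> [i|j]; first by rewrite mxE XE sgn_level.
  transitivity (\prod_(i in S j) sgn (((u r *m B)^T) i 0)).
    by apply: eq_bigr => i _; rewrite mxE XE add0r [in RHS]mxE.
  by rewrite parity_prod MS trmx_mul mulmxA MB mul0mx mxE.
case=> xl xS; pose b : 'cV[bool]_n := \col_i (x 0 i == -1).
have xE i : x 0 i = sgn (b i 0) by rewrite mxE -level_sgn.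
have Mb : M *m b = 0.
  apply/colP => j; apply: sgn_inj; rewrite -[in LHS]MS -parity_prod mxE -[RHS](xS j).
  by apply: eq_bigr => i _; rewrite xE.
have bB : (b^T <= B)%MS.
  rewrite submxE; apply/eqP/trmx_inj; rewrite trmx_mul trmxK trmx0.
  have /submxP[W ->] : ((cokermx B)^T <= M)%MS.
    rewrite eq_row_base; apply/sub_kermxP.
    by rewrite -trmx_mul mulmx_coker trmx0.
  by rewrite -mulmxA Mb mulmx0.
have [v vE] := submxP bB; have [r rE] := usurj v.
exists r; apply/rowP => i; rewrite mxE XE rE -vE xE add0r; congr sgn.
by rewrite [in LHS]mxE.
Qed.

Section Words.
Variables (N n k : nat) (X : 'M[int]_(N, n)) (B : 'M[bool]_(k, n)).
Variables (e : 'I_n -> bool) (u : 'I_N -> 'rV[bool]_k).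
Hypothesis XB : represents X B e u.

(** Up to sign, the product of the columns in [S] is the character of the sum z of their points. It
    is constant iff z = 0, as comparing the values at 0 and at unit vectors shows. *)
Lemma word_sum (S : {set 'I_n}) :
  defining_word X S = (S != set0) && (\sum_(i in S) col i B == 0).
Proof.
have [XE us] := XB; congr andb; set z := \sum_(i in S) col i B.
have prodE r : \prod_(i in S) X r i = sgn (\sum_(i in S) e i + (u r *m z) 0 0).
  rewrite (eq_bigr (fun i => sgn (e i + (u r *m B) 0 i))); last by move=> i _; rewrite XE.
  rewrite prod_sgn big_split /= /z mulmx_sumr summxE; congr (sgn (_ + _)).
  by apply: eq_bigr => i _; rewrite colE mulmxA -colE [RHS]mxE.
apply/idP/eqP => [/forallP H|z0]; last first.
  by apply/forallP => r; apply/forallP => s; rewrite !prodE z0 !mulmx0.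
apply/colP => l; have [r0 r0E] := us 0; have [r rE] := us (delta_mx 0 l).
have /eqP := forallP (H r) r0; rewrite !prodE => /sgn_inj/addrI.
by rewrite r0E rE mul0mx -rowE !mxE.
Qed.

Lemma num_words_sum j : num_words X j.+1 =
  #|[set S : {set 'I_n} | (\sum_(i in S) col i B == 0) && (#|S| == j.+1)]|.
Proof.
apply: eq_card => S; rewrite !in_set word_sum -andbA; case: eqVneq => //= ->.
by rewrite cards0 andbF.
Qed.

Let T : {set 'cV[bool]_k} := [set col i B | i in 'I_n].

(** Words of lengths 1, 2 and 3 are zero points, repeated points and solutions of a + b = c. *)
Lemma words3_sum_free :
    num_words X 1 = 0%N -> num_words X 2 = 0%N -> num_words X 3 = 0%N ->
  injective (fun i => col i B) /\ sum_free T.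
Proof.
rewrite !num_words_sum => w1 w2 w3.
have no (S : {set 'I_n}) : (0 < #|S| <= 3)%N -> \sum_(i in S) col i B != 0.
  move=> cS; apply/negP => s0.
  have [j jS /eqP] : exists2 j, #|S| = j.+1 &
      #|[set S : {set 'I_n} | (\sum_(i in S) col i B == 0) && (#|S| == j.+1)]| = 0%N.
    by move: cS; case: #|S| => [|[|[|[|?]]]] // _;
      [exists 0%N | exists 1%N | exists 2].
  rewrite cards_eq0 => /eqP/setP/(_ S).
  by rewrite in_set0 in_set s0 jS eqxx.
have n1 i : col i B != 0 by have := no [set i]; rewrite cards1 big_set1 => ->.
have inj : injective (fun i => col i B).
  move=> i j /= E; apply/eqP/negPn/negP => ij; have := no [set i; j].
  by rewrite cards2 ij big_setU1 ?inE //= big_set1 E mx_elementary eqxx => /(_ isT).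
split=> // _ _ /imsetP[i _ ->] /imsetP[j _ ->]; apply/negP => /imsetP[l _ E].
have [ij|ij] := eqVneq i j.
  by have := n1 l; rewrite -E ij mx_elementary eqxx.
have [il|il] := eqVneq i l.
  by move: E; rewrite il -[RHS]addr0 => /addrI E0; have := n1 j; rewrite E0 eqxx.
have [jl|jl] := eqVneq j l.
  by move: E; rewrite jl -[RHS]add0r => /addIr E0; have := n1 i; rewrite E0 eqxx.
have := no (i |: [set j; l]).
rewrite cardsU1 cards2 !inE negb_or ij il jl big_setU1 ?inE ?negb_or ?ij //=.
by rewrite big_setU1 ?inE //= big_set1 addrA E mx_elementary eqxx => /(_ isT).
Qed.

Lemma num_words4 : injective (fun i => col i B) -> num_words X 4 = #|zero_quads T|.
Proof.
move=> inj; rewrite num_words_sum.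
have sumE (S : {set 'I_n}) : \sum_(x in [set col i B | i in S]) x = \sum_(i in S) col i B.
  by rewrite big_imset //= => i j _ _; apply: inj.
rewrite -(card_imset _ (imset_inj inj)); apply: eq_card => A.
apply/imsetP/idP => [[S + ->]|].
  rewrite !in_set sumE card_imset // => /andP[-> ->].
  rewrite !andbT; by apply/subsetP => x /imsetP[i _ ->]; apply: imset_f.
rewrite in_set => /and3P[AT cA sA]; exists ((fun i => col i B) @^-1: A).
  have AE : [set col i B | i in (fun i => col i B) @^-1: A] = A.
    apply/setP => x; apply/imsetP/idP => [[i + ->]|xA]; first by rewrite inE.
    by have /imsetP[i _ xE] := subsetP AT x xA; exists i; rewrite // inE -xE.
  by rewrite in_set -sumE AE sA -(card_imset _ inj) AE cA.
apply/setP => x; apply/idP/imsetP => [xA|[i + ->]]; last by rewrite inE.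
by have /imsetP[i _ xE] := subsetP AT x xA; exists i; rewrite // inE -xE.
Qed.

Lemma sum_free_words3 : injective (fun i => col i B) -> sum_free T ->
  [/\ num_words X 1 = 0%N, num_words X 2 = 0%N & num_words X 3 = 0%N].
Proof.
move=> inj sf.
have TT i : col i B \in T by apply: imset_f.
have n1 i : col i B != 0.
  by apply/eqP => c0; have := sf _ _ (TT i) (TT i); rewrite c0 addr0 -c0 TT.
have z j : (forall S : {set 'I_n}, #|S| = j.+1 -> \sum_(i in S) col i B != 0) ->
    num_words X j.+1 = 0%N.
  move=> H; rewrite num_words_sum; apply/eqP; rewrite cards_eq0; apply/eqP/setP => S.
  rewrite in_set0 in_set; apply/negP => /andP[s /eqP c].
  by have := H S c; rewrite s.
split; apply: z => S.
- by move/eqP; case/cards1P => i ->; rewrite big_set1 n1.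
- move/eqP; case/cards2P => i [j [ij ->]]; rewrite big_setU1 ?inE //= big_set1.
  by rewrite (add2_eq0 (@mx_elementary k 1)); apply: contra ij => /eqP/inj ->.
move=> cS; have /set0Pn[i iS] : S != set0 by rewrite -card_gt0 cS.
have : #|S :\ i| == 2 by have := cardsD1 i S; rewrite iS cS add1n => -[<-].
case/cards2P => j [l [jl Sil]]; rewrite (big_setD1 i) //= Sil big_setU1 ?inE //= big_set1.
rewrite addrC (add2_eq0 (@mx_elementary k 1)); apply/negP => /eqP E.
by have := sf _ _ (TT j) (TT l); rewrite E TT.
Qed.

End Words.

(** * Coordinates and doubling *)

Section AdditiveInjection.
Variables (G H : finZmodType) (f : G -> H).
Hypothesis f_add : forall x y, f (x + y) = f x + f y.
Hypothesis f_inj : injective f.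

Lemma energy_imset (T : {set G}) : energy (f @: T) = energy T.
Proof.
have big_f (F : H -> nat) : (\sum_(y in f @: T) F y = \sum_(x in T) F (f x))%N.
  by rewrite big_imset //= => x y _ _; apply: f_inj.
rewrite /energy big_f; apply: eq_bigr => a _; rewrite big_f; apply: eq_bigr => b _.
by rewrite big_f; apply: eq_bigr => c _; rewrite -!f_add mem_imset.
Qed.

Lemma sum_free_imset (T : {set G}) : sum_free T -> sum_free (f @: T).
Proof.
move=> sf _ _ /imsetP[a aT ->] /imsetP[b bT ->].
by rewrite -f_add mem_imset //; apply: sf.
Qed.
End AdditiveInjection.

Lemma energy_zero_quads_eq (G H : finZmodType) (A : {set G}) (B : {set H}) :
    elementary G -> elementary H -> energy A = energy B -> #|A| = #|B| ->
  #|zero_quads A| = #|zero_quads B|.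
Proof.
move=> eG eH E C; have := energy_zero_quads eG A; have := energy_zero_quads eH B.
rewrite E C; lia.
Qed.

Definition vec4 (u : 'cV[bool]_4) : V4 :=
  (u 0 0, u 1 0, u (inord 2) 0, u (inord 3) 0).

Definition col4 (v : V4) : 'cV[bool]_4 :=
  \col_i nth false [:: v.1.1.1; v.1.1.2; v.1.2; v.2] i.

Lemma vec4K : cancel vec4 col4.
Proof.
move=> u; apply/colP => -[[|[|[|[|//]]]] hi]; rewrite mxE /=; congr (u _ 0).
- exact: val_inj.
- exact: val_inj.
- by apply: val_inj; rewrite /= inordK.
- by apply: val_inj; rewrite /= inordK.
Qed.

Lemma col4K : cancel col4 vec4.
Proof. by move=> [[[a b] c] d]; rewrite /vec4 !mxE /= !inordK. Qed.

Lemma vec4D u v : vec4 (u + v) = vec4 u + vec4 v.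
Proof. by rewrite /vec4 !mxE. Qed.

Lemma col4D u v : col4 (u + v) = col4 u + col4 v.
Proof. by apply: (can_inj vec4K); rewrite vec4D !col4K. Qed.

Lemma cap5_sum_free a b : a \in cap5 -> b \in cap5 -> a + b \notin cap5.
Proof.
have H : all (fun a => all (fun b => ~~ in_cap5 (add4 a b)) cap5) cap5 by vm_compute.
by move=> aC bC; rewrite -in_cap5E -add4E; apply: (allP (allP H a aC) b bC).
Qed.

Section Coordinates.
Variables (m : nat) (T : {set 'cV[bool]_(4 + m)}).
Hypothesis T_sum_free : sum_free T.
Variables a b c d e : 'cV[bool]_(4 + m).
Hypotheses (aT : a \in T) (bT : b \in T) (cT : c \in T) (dT : d \in T) (eT : e \in T).
Hypothesis pentagon : a + b = c + d + e.

Let G2 : elementary 'cV[bool]_(4 + m) := @mx_elementary _ _.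

Let neq1 x : x \in T -> x = 0 -> False.
Proof.
by move=> xT x0; have := T_sum_free xT xT; rewrite x0 addr0 -x0 xT.
Qed.

Let neq3 x y z : x \in T -> y \in T -> z \in T -> x + y + z = 0 -> False.
Proof.
move=> xT yT zT /eqP; rewrite (add2_eq0 G2) => /eqP E.
by have := T_sum_free xT yT; rewrite E zT.
Qed.

Let five : a + b + c + d + e = 0.
Proof. by apply/eqP; rewrite -!addrA (addrA a) (add2_eq0 G2) pentagon addrA. Qed.

Let neq2 x y z t w : z \in T -> t \in T -> w \in T ->
  x + y + (z + t + w) = a + b + c + d + e -> x + y = 0 -> False.
Proof. by move=> zT tT wT + xy; rewrite five xy add0r; apply: neq3. Qed.

Let R : 'M[bool]_(4, 4 + m) := \matrix_(j < 4) (nth 0 [:: a; b; c; d] j)^T.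

(** A vanishing sum of one or three of a, b, c, d contradicts sum-freeness directly. Since all five
    points add up to 0, a vanishing sum of two leaves three points with sum 0, and a vanishing sum
    of four gives e = 0. *)
Let R_free : row_free R.
Proof.
apply: inj_row_free => v; rewrite mulmx_sum_row !big_ord_recl big_ord0 !rowK /=.
set j1 := lift _ _; set j2 := lift _ _; set j3 := lift _ _.
rewrite addr0 -!linearZ -!raddfD /= => /eqP; rewrite trmx_eq0 => /eqP.
have v0 : v 0 ord0 = false -> v 0 j1 = false -> v 0 j2 = false -> v 0 j3 = false -> v = 0.
  move=> e0 e1 e2 e3; apply/rowP => -[[|[|[|[|//]]]] hj]; rewrite mxE.
  - by rewrite -[RHS]e0; congr (v _ _); apply: val_inj.
  - by rewrite -[RHS]e1; congr (v _ _); apply: val_inj.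
  - by rewrite -[RHS]e2; congr (v _ _); apply: val_inj.
  - by rewrite -[RHS]e3; congr (v _ _); apply: val_inj.
move: v0; rewrite !addrA.
case: (v 0 ord0) => v0; case: (v 0 j1) v0 => v0; case: (v 0 j2) v0 => v0;
  case: (v 0 j3) v0 => v0;
  rewrite ?(scale0r, add0r, addr0) -/(true : bool) -?[true]/(1 : bool) ?scale1r => E.
- by case: (neq1 eT); rewrite -[LHS]add0r -E five.
- by case: (neq3 aT bT cT).
- by case: (neq3 aT bT dT).
- by case: (neq2 cT dT eT _ E); rewrite !addrA.
- by case: (neq3 aT cT dT).
- by case: (neq2 bT dT eT _ E); rewrite !addrA (addrAC a).
- by case: (neq2 bT cT eT _ E); rewrite !addrA (addrAC a) (addrAC _ d c).
- by case: (neq1 aT).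
- by case: (neq3 bT cT dT).
- by case: (neq2 aT dT eT _ E); rewrite !addrA (AC 5 (3*1*2*4*5)).
- by case: (neq2 aT cT eT _ E); rewrite !addrA (AC 5 (3*1*4*2*5)).
- by case: (neq1 bT).
- by case: (neq2 aT bT eT _ E); rewrite !addrA (AC 5 (3*4*1*2*5)).
- by case: (neq1 cT).
- by case: (neq1 dT).
exact: v0.
Qed.

Lemma pentagon_coords : exists (th : 'cV[bool]_(4 + m) -> V4 * 'cV[bool]_m) th',
  [/\ forall x y, th (x + y) = th x + th y, cancel th th', cancel th' th
    & forall x, x \in cap5 -> (x, 0) \in th @: T].
Proof.
pose A := R^T.
have Afree : \rank A = 4 by rewrite mxrank_tr (eqP R_free).
pose L := col_ebase A; pose U := row_ebase A.
have Lu : L \in unitmx := col_ebase_unit A.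
have Uu : U \in unitmx := row_ebase_unit A.
(* The rank normal form A = L * pid * U shows that L^-1 A is [U] above 0; [W] then clears [U]. *)
pose W : 'M[bool]_(4 + m) := block_mx (invmx U) 0 0 1%:M.
have Wu : W \in unitmx.
  by rewrite unitmxE det_ublock det1 mulr1 -unitmxE unitmx_inv.
pose P := W *m invmx L.
have Pu : P \in unitmx by rewrite unitmx_mul Wu unitmx_inv.
have PA : P *m A = col_mx 1%:M 0.
  rewrite -[A]mulmx_ebase -/L -/U Afree /P -!mulmxA (mulmxA (invmx L)) mulVmx // mul1mx.
  have -> : @pid_mx bool (4 + m) 4 4 = col_mx 1%:M 0.
    apply/matrixP => i j; rewrite !mxE; case: splitP => l El; rewrite !mxE El.
      by rewrite andbT.
    by rewrite andbF.
  rewrite mulmxA mul_block_col !mul0mx !mulmx0 !addr0 mulmx1 mul_col_mx.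
  by rewrite mulVmx // mul0mx.
pose th x := (vec4 (usubmx (P *m x)), dsubmx (P *m x)).
pose th' (p : V4 * 'cV[bool]_m) := invmx P *m col_mx (col4 p.1) p.2.
have thD x y : th (x + y) = th x + th y.
  by rewrite /th mulmxDr !raddfD /= vec4D.
exists th, th'; split=> //.
- by move=> x; rewrite /th' /th /= vec4K vsubmxK mulKmx.
- by move=> [v y]; rewrite /th' /th /= mulKVmx // col_mxKu col_mxKd col4K.
have th_row (j : 'I_4) : th (nth 0 [:: a; b; c; d] j) = (vec4 (delta_mx j 0), 0).
  have -> : nth 0 [:: a; b; c; d] j = A *m delta_mx j 0.
    by rewrite -colE /A -tr_row rowK trmxK.
  by rewrite /th mulmxA PA mul_col_mx mul1mx mul0mx col_mxKu col_mxKd.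
have tha : th a = ((true, false, false, false), 0).
  by rewrite (th_row ord0) /vec4 !mxE -!val_eqE /= !inordK.
have thb : th b = ((false, true, false, false), 0).
  by rewrite (th_row (@Ordinal 4 1 isT)) /vec4 !mxE -!val_eqE /= !inordK.
have thc : th c = ((false, false, true, false), 0).
  by rewrite (th_row (@Ordinal 4 2 isT)) /vec4 !mxE -!val_eqE /= !inordK.
have thd : th d = ((false, false, false, true), 0).
  by rewrite (th_row (@Ordinal 4 3 isT)) /vec4 !mxE -!val_eqE /= !inordK.
have the : th e = ((true, true, true, true), 0).
  have -> : e = a + b + c + d by apply/eqP; rewrite eq_sym -(add2_eq0 G2) five.
  by rewrite !thD tha thb thc thd !pairD !addr0.
move=> x; rewrite /cap5 !in_cons in_nil orbF => /or4P[|||/orP[]] /eqP ->.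
- by rewrite -tha imset_f.
- by rewrite -thb imset_f.
- by rewrite -thc imset_f.
- by rewrite -thd imset_f.
- by rewrite -the imset_f.
Qed.
End Coordinates.

(** Doubling adds a coordinate to the points: 0 on the left half of the columns and 1 on the right
    half. *)
Lemma double_chars N n m (Y : 'M[int]_(N, n)) (ga : 'I_n -> V4 * 'cV[bool]_m) :
    (forall p, p.1 \in cap5 -> exists c, ga c = p) ->
    (forall f : V4 * 'cV[bool]_m -> bool, (forall x y, f (x + y) = f x + f y) ->
      exists r, forall c, Y r c = sgn (f (ga c))) ->
  exists ga' : 'I_(n + n) -> V4 * 'cV[bool]_m.+1,
    (forall p, p.1 \in cap5 -> exists c, ga' c = p) /\
    (forall f : V4 * 'cV[bool]_m.+1 -> bool, (forall x y, f (x + y) = f x + f y) ->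
      exists r, forall c, Defs.double Y r c = sgn (f (ga' c))).
Proof.
move=> surj chars.
pose ext (z : bool) (y : 'cV[bool]_m) : 'cV[bool]_m.+1 := col_mx (const_mx z : 'cV_1) y.
exists (fun c => match split c with
  | inl c => ((ga c).1, ext false (ga c).2)
  | inr c => ((ga c).1, ext true (ga c).2) end); split.
  move=> [v y] /= vC.
  have [c cE] := surj (v, dsubmx (y : 'cV_(1 + m))) vC.
  have yE : y = ext (y 0 0) (dsubmx (y : 'cV_(1 + m))).
    rewrite /ext; have <- : usubmx (y : 'cV_(1 + m)) = const_mx (y 0 0).
      by apply/matrixP => i j; rewrite !ord1 !mxE; congr (y _ _); apply: val_inj.
    exact: (esym (@vsubmxK _ 1 m 1 y)).
  case y0: (y 0 0) yE => yE.
    by exists (rshift n c); rewrite -[rshift n c]/(unsplit (inr c)) unsplitK cE /= -yE.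
  by exists (lshift n c); rewrite -[lshift n c]/(unsplit (inl c)) unsplitK cE /= -yE.
move=> f fD.
have extD z z' y y' : ext (z + z') (y + y') = ext z y + ext z' y'.
  rewrite /ext; have -> : const_mx (z + z') = const_mx z + const_mx z' :> 'cV[bool]_1.
    by apply/matrixP => i j; rewrite !mxE.
  exact: (esym (@add_col_mx _ 1 m 1 _ _ _ _)).
pose g (p : V4 * 'cV[bool]_m) := f (p.1, ext false p.2).
have [|r rE] := chars g.
  by move=> [v y] [v' y']; rewrite /g -fD !pairD /= -extD.
have fE v z y : f (v, ext z y) = g (v, y) + f (0, ext z 0).
  by rewrite /g -fD pairD addr0 /= -extD addr0 add0r.
have f0 : f (0, ext false 0) = 0.
  have -> : ext false 0 = 0 := @col_mx0 _ 1 m 1.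
  by have := fD 0 0; rewrite addr0 -[(0, 0)]/(0 : V4 * 'cV[bool]_m.+1); case: (f 0).
(* A character that is nontrivial on the new coordinate is found in the lower rows, where the right
   block changes sign. *)
case b1: (f (0, ext true 0)).
  exists (rshift N r) => c; rewrite -{1}(splitK c) /Defs.double.
  case: (split c) => c' /=.
    by rewrite block_mxEdl rE fE f0 addr0 -surjective_pairing.
  rewrite block_mxEdr mxE rE fE b1 -surjective_pairing.
  by case: (g _).
exists (lshift N r) => c; rewrite -{1}(splitK c) /Defs.double.
case: (split c) => c' /=.
  by rewrite block_mxEul rE fE f0 addr0 -surjective_pairing.
by rewrite block_mxEur rE fE b1 -surjective_pairing addr0.
Qed.

(** In the base case the five columns are the points of [cap5]. These add up to 0, so the values of
    any additive [f] on them satisfy I = ABCDE and form a row. *)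
Lemma iter_double_chars (X0 : 'M[int]_(16, 5)) m :
    defined_by X0 (fun _ : 'I_1 => [set: 'I_5]) (fun _ : 'I_1 => 1) ->
  exists ga : 'I_(iter m twice 5) -> V4 * 'cV[bool]_m,
    (forall p, p.1 \in cap5 -> exists c, ga c = p) /\
    (forall f : V4 * 'cV[bool]_m -> bool, (forall x y, f (x + y) = f x + f y) ->
      exists r, forall c, iter_double m X0 r c = sgn (f (ga c))).
Proof.
case=> _ X0rows; elim: m => [|m [ga [surj chars]]]; last exact: double_chars surj chars.
exists (fun i => (nth 0 cap5 i, 0)); split.
  move=> [v y] /= vC; have i5 : (index v cap5 < 5)%N by rewrite -index_mem in vC.
  exists (Ordinal i5) => /=; rewrite nth_index //; congr pair.
  by apply/colP => -[].
move=> f fD; have [_ [|r rE]] := X0rows (\row_i sgn (f (nth 0 cap5 i, 0))).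
  split=> [i|_]; first by rewrite mxE sgn_level.
  rewrite (eq_bigr (fun i : 'I_5 => sgn (f (nth 0 cap5 i, 0)))); last first.
    by move=> i _; rewrite mxE.
  rewrite prod_sgn (eq_bigl xpredT) => [|i]; last by rewrite in_setT.
  rewrite !big_ord_recl big_ord0 addr0 -!fD !pairD !addr0.
  have -> : f (0, 0) = 0.
    by have := fD (0, 0) (0, 0); rewrite pairD !addr0; case: (f _).
  by [].
by exists r => c; move/rowP/(_ c): rE; rewrite !mxE.
Qed.

(** If v <> 0 kills [T], take [s] in [T] and [w] with v w <> 0. None of s, w, s + w lies in
    [sumset T], the first by sum-freeness and the others because [v] does not kill them, so the
    translates of [T] by 0, s, w, s + w are disjoint and 4 * #|T| <= 2^k. *)
Lemma sum_free_spanning k (T : {set 'cV[bool]_k}) (v : 'rV[bool]_k) :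
    sum_free T -> (2 ^ k < 4 * #|T|)%N -> (forall t, t \in T -> v *m t = 0) -> v = 0.
Proof.
move=> sf big vT; apply/eqP/negPn/negP => /rV0Pn[j vj].
have G2 : elementary 'cV[bool]_k := @mx_elementary k 1.
have /set0Pn[s sT] : T != set0 by rewrite -card_gt0; case: #|T| big; rewrite ?muln0.
pose w : 'cV[bool]_k := delta_mx j 0.
have vw : v *m w != 0.
  by apply: contra vj => /eqP/matrixP/(_ 0 0); rewrite -colE !mxE => ->.
have nsum x : x \in sumset T -> v *m x = 0.
  by case/(sumsetP G2) => a [b [aT bT ->]]; rewrite mulmxDr !vT // addr0.
have ns : s \notin sumset T.
  apply/negP => /(sumsetP G2)[a [b [aT bT E]]].
  by have := sf _ _ aT bT; rewrite -E sT.
have nw : w \notin sumset T by apply: contra vw => /nsum ->.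
have nsw : s + w \notin sumset T.
  by apply: contra vw => /nsum; rewrite mulmxDr vT // add0r => ->.
pose h (p : bool * bool) := (if p.1 then s else 0) + (if p.2 then w else 0).
have ifD (x : 'cV[bool]_k) (a b : bool) :
    (if a then x else 0) + (if b then x else 0) = if a + b then x else 0.
  by case: a b => [] []; rewrite /= ?addr0 ?add0r ?G2.
have hD p q : h p + h q = h (p + q) by rewrite /h addrACA !ifD.
have h_out p : p != 0 -> h p \notin sumset T.
  by case: p => [[] []] //= _; rewrite /h /= ?addr0 ?add0r.
have z2 : 0 \in sumset T by apply/(sumsetP G2); exists s, s; rewrite G2.
have h_neq p q : p != q -> h p + h q \notin sumset T.
  move=> pq; rewrite hD; apply: h_out.
  by apply: contra pq; case: p q => [[] []] [[] []].
have h_inj : injective h.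
  move=> p q E; apply/eqP/negPn/negP => /h_neq.
  by rewrite E G2 z2.
have := @card_packing _ G2 T (h @: setT).
rewrite card_imset // cardsT card_prod card_bool card_mx card_bool muln1 => H.
suff : (2 * 2 * #|T| <= 2 ^ k)%N by rewrite leqNgt big.
apply: H => _ _ /imsetP[p _ ->] /imsetP[q _ ->] pq.
by apply: h_neq; apply: contra pq => /eqP ->.
Qed.

Lemma design_of_sum_free k (T : {set 'cV[bool]_k}) :
    (0 < k)%N -> sum_free T -> (2 ^ k < 4 * #|T|)%N ->
  exists Y : 'M[int]_(2 ^ k, #|T|), [/\ is_regular Y, num_words Y 1 = 0%N,
    num_words Y 2 = 0%N, num_words Y 3 = 0%N & num_words Y 4 = #|zero_quads T|].
Proof.
move=> k0 sf big.
pose B : 'M[bool]_(k, #|T|) := \matrix_(r, i) (enum_val i : 'cV[bool]_k) r 0.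
have colB i : col i B = enum_val i by apply/colP => r; rewrite !mxE.
have c2 : (2 ^ k)%N = #|{: 'rV[bool]_k}| by rewrite card_mx card_bool mul1n.
pose u (r : 'I_(2 ^ k)) : 'rV[bool]_k := enum_val (cast_ord c2 r).
have uinj : injective u by move=> r r' /enum_val_inj/cast_ord_inj.
have usurj v : exists r, u r = v.
  by exists (cast_ord (esym c2) (enum_rank v)); rewrite /u cast_ordKV enum_rankK.
pose Y : 'M[int]_(2 ^ k, #|T|) := \matrix_(r, i) sgn ((u r *m B) 0 i).
have rep : represents Y B (fun=> false) u.
  by split=> // r i; rewrite mxE add0r.
have inj : injective (fun i => col i B).
  by move=> i j; rewrite !colB => /enum_val_inj.
have TE : [set col i B | i in 'I_#|T|] = T.
  apply/setP => x; apply/imsetP/idP => [[i _ ->]|xT].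
    by rewrite colB enum_valP.
  by exists (enum_rank_in xT x); rewrite // colB enum_rankK_in.
have Bfree : row_free B.
  apply: inj_row_free => v vB; apply: (sum_free_spanning sf big) => t.
  by rewrite -{1}TE => /imsetP[i _ ->]; rewrite colE mulmxA vB mul0mx.
have [w1 w2 w3] := sum_free_words3 rep inj (eq_ind_r (fun A => sum_free A) sf TE).
exists Y; split=> //; first exact: regular_of_points Bfree uinj rep.
by rewrite (num_words4 rep inj) TE.
Qed.

Lemma lexi_words N n (X Y : 'M[int]_(N, n)) : (3 < n)%N ->
    (wordlength_pattern X <= wordlength_pattern Y)%O ->
    num_words Y 1 = 0%N -> num_words Y 2 = 0%N -> num_words Y 3 = 0%N ->
  [/\ num_words X 1 = 0%N, num_words X 2 = 0%N, num_words X 3 = 0%N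
    & (num_words X 4 <= num_words Y 4)%N].
Proof.
(* [l] is the first position where the patterns differ, or n if they agree. The entry of [X] is
   strictly smaller there, which is impossible where [Y] has 0; so l > 2 and position 3, holding
   B_4, is still compared. *)
move=> n4 /lexi_tupleP[l lP] y1 y2 y3.
have H j (jn : (j < n)%N) : (j <= l)%N ->
    (num_words X j.+1 <= num_words Y j.+1)%N /\
    (num_words X j.+1 == num_words Y j.+1) = (j != l).
  by move=> jl; have := lP (Ordinal jn) jl; rewrite !tnth_mktuple /= => -[].
have small j (jn : (j < n)%N) : (j <= l)%N -> num_words Y j.+1 = 0%N ->
    num_words X j.+1 = 0%N /\ (j < l)%N.
  move=> jl yj; have [] := H j jn jl; rewrite yj leqn0 => /eqP ->.
  by rewrite eqxx => /esym jl'; rewrite ltn_neqAle jl' jl.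
have [x1 l1] := small 0%N (ltnW (ltnW (ltnW n4))) (leq0n l) y1.
have [x2 l2] := small 1%N (ltnW (ltnW n4)) l1 y2.
have [x3 l3] := small 2 (ltnW n4) l2 y3.
by have [] := H 3 n4 l3.
Qed.

(** * The points of the doubled design and their subsets with few zero quads *)

Section CapPoints.
Variable m : nat.

Definition cap_points : {set V4 * 'cV[bool]_m} := [set p | p.1 \in cap5].

Let g (y : 'cV[bool]_m) (v : V4) : V4 * 'cV[bool]_m := (v, y).

Let card_cV : #|[set: 'cV[bool]_m]| = (2 ^ m)%N.
Proof. by rewrite cardsT card_mx card_bool muln1. Qed.

Let g_add d e s t : d \in [set: 'cV[bool]_m] -> e \in [set: 'cV[bool]_m] ->
  g d s + g e t = g (d + e) (s + t).
Proof. by []. Qed.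

Let g_inj d e s t : d \in [set: 'cV[bool]_m] -> e \in [set: 'cV[bool]_m] ->
  g d s = g e t -> d = e /\ s = t.
Proof. by move=> _ _ E; split; [exact: (congr1 snd E) | exact: (congr1 fst E)]. Qed.

Let g_mem d s : d \in [set: 'cV[bool]_m] ->
  (g d s \in cap_points) = (s \in [set c : V4 in cap5]).
Proof. by move=> _; rewrite [LHS]in_set [RHS]in_set. Qed.

Let g_surj p : p \in cap_points -> exists2 d, d \in [set: 'cV[bool]_m] & exists s, p = g d s.
Proof. by case: p => v y _; exists y; [exact: in_setT | exists v]. Qed.

Let setT_add d e : d \in [set: 'cV[bool]_m] -> e \in [set: 'cV[bool]_m] ->
  d + e \in [set: 'cV[bool]_m].
Proof. by move=> *; exact: in_setT. Qed.

Lemma card_cap_points : #|cap_points| = (5 * 2 ^ m)%N.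
Proof. by rewrite (card_param g_inj g_mem g_surj) card_cV card_cap5 mulnC. Qed.

Lemma energy_cap_points : energy cap_points = (65 * (2 ^ m) ^ 3)%N.
Proof.
by rewrite (energy_param setT_add g_add g_inj g_mem g_surj) card_cV energy_cap5 mulnC.
Qed.

Lemma cap_points_sum_free : sum_free cap_points.
Proof.
by move=> [v x] [w y]; rewrite !in_set /=; apply: cap5_sum_free.
Qed.

End CapPoints.

Lemma sum_free_sub (G : finZmodType) (S T : {set G}) :
  S \subset T -> sum_free T -> sum_free S.
Proof.
move=> /subsetP ST sf a b aS bS; apply: contra (sf a b (ST a aS) (ST b bS)).
exact: ST.
Qed.

(* [w] is the number of zero quads among all the columns of the doubled design. *)
Lemma projection_few_quads m n : (0 < m)%N -> (9 * 2 ^ m <= 2 * n)%N -> (n <= 5 * 2 ^ m)%N ->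
  exists (Y : 'M[int]_(2 ^ (4 + m), n)) w, [/\ is_regular Y, num_words Y 1 = 0%N,
    num_words Y 2 = 0%N, num_words Y 3 = 0%N &
    (num_words Y 4 * 'C(5 * 2 ^ m, 4) <= w * 'C(n, 4))%N /\
    (24 * w + 75 * (2 ^ m) ^ 2 = 65 * (2 ^ m) ^ 3 + 10 * 2 ^ m)%N].
Proof.
move=> m0 nlo nhi; set q := (2 ^ m)%N in nlo nhi *.
have eV : elementary (V4 * 'cV[bool]_m)%type.
  by apply: pair_elementary; [exact: V4_elementary | exact: mx_elementary].
have [|S ST [cS wS]] := @zero_quads_sub _ (cap_points m) n.
  by rewrite card_cap_points.
pose ps (p : V4 * 'cV[bool]_m) : 'cV[bool]_(4 + m) := col_mx (col4 p.1) p.2.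
have psD p p' : ps (p + p') = ps p + ps p'.
  by rewrite /ps add_col_mx -col4D.
have ps_inj : injective ps.
  move=> [v x] [w y] /eq_col_mx[/= /(can_inj col4K) -> ->]; by [].
have cT : #|ps @: S| = n by rewrite card_imset.
have [||Y] := @design_of_sum_free (4 + m) (ps @: S) isT.
- exact/sum_free_imset/(sum_free_sub ST)/cap_points_sum_free.
(* From 9 q <= 2 n follows 4 n >= 18 q > 16 q. *)
- rewrite cT expnD -/q; lia.
case: n / cT {nlo nhi} cS wS Y => cS wS Y [Yr y1 y2 y3 y4].
exists Y, #|zero_quads (cap_points m)|; split=> //; split; last first.
  have := energy_zero_quads eV (cap_points m).
  rewrite card_cap_points energy_cap_points -/q; lia.
rewrite y4 (_ : #|zero_quads (ps @: S)| = #|zero_quads S|).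
  by move: wS; rewrite card_cap_points.
apply: energy_zero_quads_eq => //; first exact: mx_elementary.
exact: energy_imset.
Qed.

(** * Comparison of the numbers of words of length four *)

Section NumericZ.
Local Open Scope Z_scope.

(** To leading order Cauchy-Schwarz bounds the energy below by n^4 / (8 q), while averaging over the
    5 q cap points bounds it above by 65 q^3 (n / (5 q))^4 = 13 n^4 / (125 q), which is smaller. *)
Lemma quads_ineq_sumset (q n D W w : Z) :
  2 <= q -> 9 * q <= 2 * n -> D = n * (n - 1) ->
  D * D <= (8 * q - 1) * (24 * W + 2 * D) ->
  W * (5 * q * (5 * q - 1) * (5 * q - 2) * (5 * q - 3)) <= w * (D * (n - 2) * (n - 3)) ->
  24 * w = 5 * q * (q - 1) * (13 * q - 2) -> False.
Proof.
intros q2 nq DE H1 H2 H3.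
set (G := (5 * q - 1) * (5 * q - 2) * (5 * q - 3)).
assert (Gpos : 0 < G) by (unfold G; repeat apply Z.mul_pos_pos; lia).
assert (Dpos : 0 < D) by (rewrite DE; apply Z.mul_pos_pos; lia).
set (K := (q - 1) * (13 * q - 2) * ((n - 2) * (n - 3))).
assert (H4 : 24 * W * G <= D * K).
{ apply Z.mul_le_mono_pos_l with (p := 5 * q); [lia|].
  replace (5 * q * (24 * W * G)) with (24 * (W * (5 * q * (5 * q - 1) * (5 * q - 2) * (5 * q - 3)))) by (unfold G; ring).
  replace (5 * q * (D * K)) with (24 * w * (D * (n - 2) * (n - 3))) by (rewrite H3; unfold K; ring).
  lia. }
assert (H5 : D * G <= (8 * q - 1) * (K + 2 * G)).
{ apply Z.mul_le_mono_pos_l with (p := D); [lia|].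
  apply Z.le_trans with ((8 * q - 1) * (24 * W + 2 * D) * G).
  - replace (D * (D * G)) with (D * D * G) by ring.
    apply Z.mul_le_mono_nonneg_r; lia.
  - replace (D * ((8 * q - 1) * (K + 2 * G))) with ((8 * q - 1) * (D * K + 2 * D * G)) by ring.
    replace ((8 * q - 1) * (24 * W + 2 * D) * G) with ((8 * q - 1) * (24 * W * G + 2 * D * G)) by ring.
    apply Z.mul_le_mono_nonneg_l; lia. }
destruct (Z_of_nat_complete (q - 2)) as [x Hx]; [lia|].
destruct (Z_of_nat_complete (2 * n - 9 * q)) as [s Hs]; [lia|].
assert (qE : q = Z.of_nat x + 2) by lia.
assert (nE : 2 * n = 9 * q + Z.of_nat s) by lia.
clear Hx Hs.
assert (x0 : 0 <= Z.of_nat x) by lia; assert (s0 : 0 <= Z.of_nat s) by lia.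
revert qE nE x0 s0; generalize (Z.of_nat x) (Z.of_nat s); intros X S qE nE X0 S0.
(* Writing [q = X + 2] and [2 n = 9 q + S] makes all the coefficients positive. *)
assert (E : 4 * (D * G - (8 * q - 1) * (K + 2 * G)) =
  1701 * X^5 + 14743 * X^4 + 50682 * X^3 + 86288 * X^2 + 72672 * X + 378 * (X^4 * S)
  + 3508 * (X^3 * S) + 11378 * (X^2 * S) + 15640 * (X * S) + 24192 + 7776 * S
  + 21 * (X^3 * S^2) + 109 * (X^2 * S^2) + 208 * (X * S^2) + 144 * S^2).
{ unfold K, G; rewrite DE.
  replace (4 * (n * (n - 1) * ((5 * q - 1) * (5 * q - 2) * (5 * q - 3)) -
    (8 * q - 1) * ((q - 1) * (13 * q - 2) * ((n - 2) * (n - 3)) +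
    2 * ((5 * q - 1) * (5 * q - 2) * (5 * q - 3))))) with
   ((2 * n * (2 * n - 2)) * ((5 * q - 1) * (5 * q - 2) * (5 * q - 3)) -
    (8 * q - 1) * ((q - 1) * (13 * q - 2) * ((2 * n - 4) * (2 * n - 6)) +
    8 * ((5 * q - 1) * (5 * q - 2) * (5 * q - 3)))) by ring.
  rewrite nE qE; ring. }
assert (P : forall a b, 0 <= X ^ a * S ^ b).
{ intros a b; apply Z.mul_nonneg_nonneg; apply Z.pow_nonneg; lia. }
pose proof (P 5 0); pose proof (P 4 0); pose proof (P 3 0); pose proof (P 2 0).
pose proof (P 4 1); pose proof (P 3 1); pose proof (P 2 1); pose proof (P 1 1).
pose proof (P 3 2); pose proof (P 2 2); pose proof (P 1 2); pose proof (P 0 2).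
lia.
Qed.

(** With q = 2 h and n = 9 h, the leading terms are 393 h^3 for the blow-up of the 9-cap and 520
    (9/10)^4 h^3 < 342 h^3 for the average. *)
Lemma quads_ineq_exceptional (h W w : Z) :
  1 <= h -> 24 * W = 393 * h^3 - 243 * h^2 + 18 * h ->
  W * (10 * h * (10 * h - 1) * (10 * h - 2) * (10 * h - 3)) <=
    w * (9 * h * (9 * h - 1) * (9 * h - 2) * (9 * h - 3)) ->
  24 * w = 10 * h * (2 * h - 1) * (26 * h - 2) -> False.
Proof.
intros h1 HW H Hw.
assert (H' : (393 * h^3 - 243 * h^2 + 18 * h) * (10 * h * (10 * h - 1) * (10 * h - 2) * (10 * h - 3)) <=
  10 * h * (2 * h - 1) * (26 * h - 2) * (9 * h * (9 * h - 1) * (9 * h - 2) * (9 * h - 3))).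
{ rewrite -HW -Hw; lia. }
(* In terms of g = h - 1 all coefficients of the difference are positive. *)
assert (hE : exists g, h = g + 1 /\ 0 <= g) by (exists (h - 1); lia).
destruct hE as [g [-> g0]].
assert (E : (393 * (g+1)^3 - 243 * (g+1)^2 + 18 * (g+1)) * (10 * (g+1) * (10 * (g+1) - 1) * (10 * (g+1) - 2) * (10 * (g+1) - 3)) -
  10 * (g+1) * (2 * (g+1) - 1) * (26 * (g+1) - 2) * (9 * (g+1) * (9 * (g+1) - 1) * (9 * (g+1) - 2) * (9 * (g+1) - 3))
  = 10 * (g+1) * (51828 * g^6 + 256446 * g^5 + 521166 * g^4 + 555162 * g^3 + 325566 * g^2 + 99048 * g + 12096)) by ring.
assert (Q : 0 < 51828 * g^6 + 256446 * g^5 + 521166 * g^4 + 555162 * g^3 + 325566 * g^2 + 99048 * g + 12096).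
{ assert (P : forall a, 0 <= g ^ a) by (intros a; apply Z.pow_nonneg; lia).
  pose proof (P 6); pose proof (P 5); pose proof (P 4); pose proof (P 3); pose proof (P 2).
  lia. }
assert (0 < 10 * (g + 1)) by lia.
pose proof (Z.mul_pos_pos _ _ H0 Q); lia.
Qed.

End NumericZ.

Lemma bin4 n : (24 * 'C(n, 4) = n * (n - 1) * (n - 2) * (n - 3))%N.
Proof.
have := bin_ffact n 4; rewrite (_ : 4`! = 24)%N // mulnC => ->.
by rewrite !ffactnS ffactn0 muln1 -!subn1 -!subnDA !mulnA.
Qed.

(* [%Z] denotes MathComp's [int_scope] here. *)
Local Delimit Scope Z_scope with Zst.

Lemma bin4Z n : (3 <= n)%N -> (24 * Z.of_nat (binomial n 4) =
  Z.of_nat n * (Z.of_nat n - 1) * (Z.of_nat n - 2) * (Z.of_nat n - 3))%Zst.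
Proof.
move=> n3; have := bin4 n.
have -> : (Z.of_nat n - 1 = Z.of_nat (n - 1)%N)%Zst by lia.
have -> : (Z.of_nat n - 2 = Z.of_nat (n - 2)%N)%Zst by lia.
have -> : (Z.of_nat n - 3 = Z.of_nat (n - 3)%N)%Zst by lia.
by move: (binomial n 4) (n - 1)%N (n - 2)%N (n - 3)%N => c a b d; lia.
Qed.

Lemma quads_ineq_sumset_nat (q n E s W w y : nat) :
  (2 <= q)%N -> (9 * q <= 2 * n)%N -> (n <= 5 * q)%N -> (2 * s <= 16 * q)%N ->
  ((n ^ 2 - n) ^ 2 <= s.-1 * (E - n ^ 2))%N ->
  (E + 2 * n = 24 * W + 3 * n ^ 2)%N -> (W <= y)%N ->
  (y * 'C(5 * q, 4) <= w * 'C(n, 4))%N ->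
  (24 * w + 75 * q ^ 2 = 65 * q ^ 3 + 10 * q)%N -> False.
Proof.
move=> q2 nlo nhi sq H1 H2 Wy H3 H4.
have n9 : (9 <= n)%N by lia.
have [d dE] : exists d, (d + n = n * n)%N by exists (n * n - n)%N; rewrite subnK // leq_pmulr //; lia.
have eF : (E - n ^ 2 = 24 * W + 2 * d)%N by lia.
have ed : (n ^ 2 - n = d)%N by lia.
rewrite eF ed in H1.
(* Adding one more copy of the second factor to both sides avoids the truncated subtraction in
   [s.-1]. *)
have H5 : (d * d + (24 * W + 2 * d) <= 8 * q * (24 * W + 2 * d))%N.
  rewrite (leq_trans (leq_add H1 (leqnn _))) // addnC -mulSn leq_mul2r.
  by apply/orP; right; lia.
have b1 := @bin4Z (5 * q)%N ltac:(lia); have b2 := @bin4Z n ltac:(lia).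
have H6 : (W * 'C(5 * q, 4) <= w * 'C(n, 4))%N.
  by rewrite (leq_trans _ H3) // leq_mul2r Wy orbT.
apply: (@quads_ineq_sumset (Z.of_nat q) (Z.of_nat n) (Z.of_nat d) (Z.of_nat W) (Z.of_nat w)).
- lia.
- lia.
- lia.
- by move: H5; clear; lia.
- have : (24 * (Z.of_nat W * Z.of_nat (binomial (5 * q)%N 4)) <= 24 * (Z.of_nat w * Z.of_nat (binomial n 4)))%Zst.
    by lia.
  have -> : Z.of_nat d = (Z.of_nat n * (Z.of_nat n - 1))%Zst by lia.
  move: b1 b2; move: (binomial (5 * q)%N 4) (binomial n 4) => c1 c2.
  have -> : Z.of_nat (5 * q)%N = (5 * Z.of_nat q)%Zst by lia.
  move: (Z.of_nat n) (Z.of_nat q) (Z.of_nat c1) (Z.of_nat c2) (Z.of_nat W) (Z.of_nat w).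
  move=> N Q C1 C2 W' w' b1 b2 HH.
  have -> : (W' * (5 * Q * (5 * Q - 1) * (5 * Q - 2) * (5 * Q - 3)) = 24 * (W' * C1))%Zst.
    by rewrite -b1; lia.
  have -> : (w' * (N * (N - 1) * (N - 2) * (N - 3)) = 24 * (w' * C2))%Zst.
    by rewrite -b2; lia.
  exact: HH.
- lia.
Qed.

Lemma quads_ineq_exceptional_nat (h q n E W w y : nat) :
  (2 <= q)%N -> q = (2 * h)%N -> n = (9 * h)%N -> E = (393 * h ^ 3)%N ->
  (E + 2 * n = 24 * W + 3 * n ^ 2)%N -> (W <= y)%N ->
  (y * 'C(5 * q, 4) <= w * 'C(n, 4))%N ->
  (24 * w + 75 * q ^ 2 = 65 * q ^ 3 + 10 * q)%N -> False.
Proof.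
move=> q2 qE nE -> H2 Wy H3 H4; rewrite qE nE in q2 H2 H3 H4 *.
have b1 := @bin4Z (5 * (2 * h))%N ltac:(lia); have b2 := @bin4Z (9 * h)%N ltac:(lia).
have H6 : (W * 'C(5 * (2 * h), 4) <= w * 'C(9 * h, 4))%N.
  by rewrite (leq_trans _ H3) // leq_mul2r Wy orbT.
apply: (@quads_ineq_exceptional (Z.of_nat h) (Z.of_nat W) (Z.of_nat w)).
- lia.
- lia.
- have : (24 * (Z.of_nat W * Z.of_nat (binomial (5 * (2 * h))%N 4)) <=
          24 * (Z.of_nat w * Z.of_nat (binomial (9 * h)%N 4)))%Zst by lia.
  move: b1 b2; move: (binomial (5 * (2 * h))%N 4) (binomial (9 * h)%N 4) => c1 c2.
  have -> : Z.of_nat (5 * (2 * h))%N = (10 * Z.of_nat h)%Zst by lia.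
  have -> : Z.of_nat (9 * h)%N = (9 * Z.of_nat h)%Zst by lia.
  move: (Z.of_nat h) (Z.of_nat c1) (Z.of_nat c2) (Z.of_nat W) (Z.of_nat w).
  by move=> Hh C1 C2 W' w' <- <-; lia.
- lia.
Qed.

(** * From a minimum aberration design to a projection of the doubled design *)

Lemma card_imset_col k n (B : 'M[bool]_(k, n)) : injective (fun i => col i B) ->
  #|[set col i B | i in 'I_n]| = n.
Proof. by move=> inj; rewrite card_imset // card_ord. Qed.

Theorem theorem4p1 (N k n : nat) (hk : (5 <= k)%N) (hN : N = (2 ^ k)%N)
    (hn_lo : (9 * N <= 32 * n)%N) (hn_hi : (16 * n <= 5 * N)%N)
    (X0 : 'M[int]_(16, 5))
    (hX0 : defined_by X0 (fun _ : 'I_1 => [set: 'I_5]) (fun _ : 'I_1 => 1))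
    (X : 'M[int]_(N, n)) (hX : minimum_aberration X) :
  exists P : 'M[int]_(iter (k - 4) twice 16%N, n),
    is_projection P (iter_double (k - 4) X0) /\ isomorphic X P.
Proof.
have [m kE] : exists m, k = (4 + m)%N by exists (k - 4)%N; lia.
subst k; rewrite (_ : (4 + m - 4)%N = m); last by lia.
have m0 : (0 < m)%N by lia.
subst N; set q := (2 ^ m)%N; have NE : (2 ^ (4 + m))%N = (16 * q)%N by rewrite expnD.
have q2 : (2 <= q)%N by rewrite /q (@leq_exp2l 2 1 m).
have nlo : (9 * q <= 2 * n)%N by lia.
have nhi : (n <= 5 * q)%N by lia.
have [Xreg Xmin] := hX.
have [Y [w [Yreg y1 y2 y3 [y4 wE]]]] := projection_few_quads m0 nlo nhi.
have [|x1 x2 x3 x4] := lexi_words _ (Xmin Y Yreg) y1 y2 y3; first by lia.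
have [B [e [u [Bfree XB]]]] := regular_represented erefl Xreg.
have [inj sf] := words3_sum_free XB x1 x2 x3.
have xT := num_words4 XB inj.
set T : {set 'cV[bool]_(4 + m)} := [set col i B | i in 'I_n] in sf xT.
have cT : #|T| = n := card_imset_col inj.
have G2 : elementary 'cV[bool]_(4 + m) := @mx_elementary _ _.
have T0 : T != set0 by rewrite -card_gt0 cT; lia.
have eT := energy_zero_quads G2 T; rewrite cT -xT in eT.
have [/forall_inP small|] := boolP [forall x in sumset T, [forall t in T, x + t \notin sumset T]].
  have sT : (2 * #|sumset T| <= 16 * q)%N.
    have <- : #|{: 'cV[bool]_(4 + m)}| = (16 * q)%N by rewrite card_mx card_bool muln1.
    by apply: sumset_small T0 _ => x /small /forall_inP.
  have := energy_sumset G2 T0; rewrite cT => eS.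
  by case: (quads_ineq_sumset_nat q2 nlo nhi sT eS eT x4 y4 wE).
rewrite negb_forall_in => /exists_inP[x xS]; rewrite negb_forall_in => /exists_inP[t tT].
rewrite negbK => /(sumsetP G2)[a [b [aT bT E]]].
have [c [d [cT' dT xE]]] := sumsetP G2 _ _ xS.
have pent : a + b = c + d + t by rewrite -E xE.
have [th [th' [thD thK thK' thC]]] := pentagon_coords sf aT bT cT' dT tT pent.
have V2 := @mx_elementary m 1.
have sf' := sum_free_imset thD (can_inj thK) sf.
have cT2 : #|th @: T| = n by rewrite card_imset ?cT //; exact: can_inj thK.
have cQ : #|{: 'cV[bool]_m}| = q by rewrite card_mx card_bool muln1.
have big : (9 * #|{: 'cV[bool]_m}| <= 2 * #|th @: T|)%N by rewrite cQ cT2.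
case: (sum_free_structure V2 sf' thC big) => [[Phi [PhiD PhiC]]|[h [h1 h2 h3]]]; last first.
  rewrite cQ in h1; rewrite cT2 in h2; rewrite energy_imset // in h3; last exact: can_inj thK.
  by case: (quads_ineq_exceptional_nat q2 h1 h2 h3 eT x4 y4 wE).
have [ga [ga_surj ga_char]] := iter_double_chars m hX0.
(* The shear moves every column point into [cap5] times F_2^m, where it is the point of some column
   of the doubled design. *)
pose pt i := let p := th (col i B) in (p.1 + Phi p.2, p.2).
have /fin_all_exists[cc ccE] i : exists j, ga j = pt i.
  apply: ga_surj => /=; apply: (centredP _ _ _ (PhiC _)).
  by rewrite -surjective_pairing; do 2![apply: imset_f].
have rowP' r : exists s, forall i, iter_double m X0 s (cc i) = sgn ((u r *m B) 0 i).
  (* The shear is its own inverse, so [f] sends [pt i] to the entry of [u r *m B] in column [i]. *)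
  pose f (p : V4 * 'cV[bool]_m) := (u r *m th' (p.1 + Phi p.2, p.2)) 0 0.
  have fD p p' : f (p + p') = f p + f p'.
    rewrite /f PhiD addrACA -pairD.
    have -> z z' : th' (z + z') = th' z + th' z'.
      by apply: (can_inj thK); rewrite thD !thK'.
    by rewrite mulmxDr mxE.
  have [s sE] := ga_char f fD; exists s => i.
  rewrite sE ccE /f /pt /= -addrA V4_elementary addr0 -surjective_pairing thK.
  by rewrite colE mulmxA -colE mxE.
have /fin_all_exists[fr frE] := rowP'.
exists (colsub cc (iter_double m X0)); split.
  exists cc; split=> // i j ij.
  have := congr1 ga ij; rewrite !ccE => pij.
  apply: inj; apply: (can_inj thK).
  have e2 : (th (col i B)).2 = (th (col j B)).2 := congr1 snd pij.
  have e1 : (th (col i B)).1 + Phi (th (col i B)).2 = (th (col j B)).1 + Phi (th (col j B)).2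
    := congr1 fst pij.
  rewrite e2 in e1; rewrite [LHS]surjective_pairing [RHS]surjective_pairing e2.
  by rewrite (addIr _ e1).
exists fr, 1%g, e; split; last first.
  move=> r i; rewrite perm1 mxE frE; have [-> _] := XB.
  by rewrite sgnD.
have Xinj : injective (fun r => row r X).
  by have [p [S [eps [_ _ _ _ []]]]] := Xreg.
have frinj : injective fr.
  move=> r s rs; apply: Xinj; apply/rowP => i; rewrite !mxE; have [XE _] := XB.
  by rewrite !XE !sgnD -!frE rs.
apply: inj_card_bij frinj _; rewrite !card_ord NE.
have itE j : iter j twice 16 = (16 * 2 ^ j)%N.
  by elim: j => //= j ->; rewrite /twice expnS; lia.
by rewrite itE.
Qed.
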